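(* There is a numerical constant $C$ with the following property. Let $(f_n)_{n\in\mathbb N}$ be a sequence in $H^1(dm)$ and let $t>0$. Assume that for all subsets $E\subset\mathbb N$ and all measurable subsets $F\subset\mathbb T$, $$\sum_{n\in E}\int_F|f_n|\,dm\le |E|\vee t^{-1}m(F).$$ Then there is a decomposition $f_n=g_n+h_n$ with $g_n\in H^1(dm)$, $h_n\in H^\infty(dm)$, such that $$\sup_{n\in\mathbb N}\|g_n\|_{H^1(dm)}\le C\quad\text{and}\quad\Big\|\sum_{n\in\mathbb N}|h_n|\Big\|_{L^\infty(dm)}\le C\,t^{-1}.$$
   Context: $\mathbb T$ is the unit circle with normalized Lebesgue measure $m$. For $1\le p\le\infty$, $H^p(dm)$ is the subspace of $L^p(dm)$ of functions $f$ with Fourier coefficients $\hat f(k)=0$ for all $k<0$. $|E|$ is the cardinality of $E$, and $u\vee v=\max(u,v)$. *)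

(* Defs.v *)
From HB Require Import structures.
From mathcomp Require Import all_boot all_order all_algebra.
From mathcomp Require Import all_classical all_reals all_analysis.
Set Implicit Arguments. Unset Strict Implicit. Unset Printing Implicit Defensive.
Import Order.TTheory GRing.Theory Num.Theory.
Import numFieldNormedType.Exports.
Local Open Scope classical_set_scope.
Local Open Scope ring_scope.

(* The unit circle T is parametrized by [0,1) via x |-> exp(2 pi i x);
   normalized Lebesgue measure m on T corresponds to Lebesgue measure on [0,1). *)
Definition Tc (R : realType) : set R := `[0%R, 1%R[.
Definition mT (R : realType) := (@lebesgue_measure R).
Arguments Tc R : clear implicits.
Arguments mT R : clear implicits.

(* A complex-valued function on T is a pair (Re f, Im f) of real functions. *)
Definition cfun (R : realType) := ((R -> R) * (R -> R))%type.

Definition cabs (R : realType) (f : cfun R) (x : R) : R :=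
  Num.sqrt (f.1 x ^+ 2 + f.2 x ^+ 2).

Definition cf_add (R : realType) (f g : cfun R) : cfun R :=
  (fun x => f.1 x + g.1 x, fun x => f.2 x + g.2 x).

Definition L1 (R : realType) (f : cfun R) : Prop :=
  [/\ measurable_fun (Tc R) f.1, measurable_fun (Tc R) f.2 &
      (mT R).-integrable (Tc R) (fun x => (cabs f x)%:E)].

(* \hat f(-k) = \int_0^1 f(x) e^{2 pi i k x} dx; real and imaginary parts *)
Definition fourier_neg_re (R : realType) (f : cfun R) (k : nat) : \bar R :=
  (\int[mT R]_(x in Tc R)
     (f.1 x * cos (2 * pi * k%:R * x) - f.2 x * sin (2 * pi * k%:R * x))%:E)%E.
Definition fourier_neg_im (R : realType) (f : cfun R) (k : nat) : \bar R :=
  (\int[mT R]_(x in Tc R)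
     (f.1 x * sin (2 * pi * k%:R * x) + f.2 x * cos (2 * pi * k%:R * x))%:E)%E.

Definition H1 (R : realType) (f : cfun R) : Prop :=
  L1 f /\ forall k : nat, (0 < k)%N ->
    fourier_neg_re f k = 0%E /\ fourier_neg_im f k = 0%E.

(* H^infty(dm): essentially bounded functions in H^1 (L^infty is contained in L^1
   since m is a probability measure) *)
Definition Hinf (R : realType) (f : cfun R) : Prop :=
  H1 f /\ exists M : R, {ae mT R, forall x, Tc R x -> cabs f x <= M}.

Definition int_abs (R : realType) (f : cfun R) (F : set R) : \bar R :=
  (\int[mT R]_(x in F) (cabs f x)%:E)%E.

(* Main.v *)
Require Import Defs.
From HB Require Import structures.
From mathcomp Require Import all_boot all_order all_algebra.
From mathcomp Require Import all_classical all_reals all_analysis.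
From mathcomp Require Import measurable_realfun complex zify ring lra.
Set Implicit Arguments. Unset Strict Implicit. Unset Printing Implicit Defensive.
Import Order.TTheory GRing.Theory Num.Theory.
Import numFieldNormedType.Exports.
Local Open Scope classical_set_scope.
Local Open Scope ring_scope.

(** One looks for bounded holomorphic multipliers [Psi_n] and puts
    [h_n = f_n Psi_n], [g_n = f_n (1 - Psi_n)].  For finitely many [n], and with
    the sum of the [|h_n|] tested only on finitely many arcs, a minimax argument
    reduces the two bounds to a single weighted one: for weights [q_n] and a step
    function [v], one needs
      [sum q_n int |f_n| |1 - Psi_n| + t int v sum |f_n| |Psi_n| <= C (sum q_n + int v)].
    Choose a trigonometric polynomial [U], analytic, with [Re U >= sqrt v] and
    [int |U|^2 <= C int v] (a combination of analytic Fejer kernels), and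
    [Psi_n = z^2 (3 - 2 z)] with [z = 1 / (1 + sqrt (t / q_n) U)].  Then
      [q_n |1 - Psi_n| + t v |Psi_n| <= 8 min (q_n, t |U|^2)],
    and integrating the hypothesis over the level sets of [q] and [t |U|^2] bounds
    [sum int |f_n| min (q_n, t |U|^2)] by [sum q_n + int |U|^2].
    The admissible families at increasing levels form a decreasing sequence of
    convex sets; almost minimal ones in a weighted L^2 norm converge almost
    everywhere along a subsequence, and Lebesgue differentiation turns the bounds
    on dyadic arcs into a pointwise one. *)

Local Notation normc := ComplexField.Normc.normc.

(** The obstacle is conjugation: an analytic [U] whose real part dominates a weight has an imaginary
    part that is controlled in L^2 but not in L^1. This is why [Re U] majorizes [sqrt v] and not
    [v], so that [int |U|^2] is compared with [int v]. The square must then be recovered in the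
    costs, and the double zeros of the cubic at z = 0 and z = 1 supply it. For fixed [f_n] both
    costs are convex in [Psi_n], which makes the minimax reduction possible. All multipliers obey
    one pointwise bound, 5, which provides the dominating functions when limits are taken. The final
    constant is 4097 = 8 * 512 + 1: 8 from the cubic, 512 from the majorant [U], and 1 from an
    infimum that need not be attained. *)

Lemma sqr_normr (R : realDomainType) (x : R) : `|x| ^+ 2 = x ^+ 2.
Proof. by rewrite real_normK// num_real. Qed.

(** * Minimax for finitely many convex costs *)

(** Minimize the sum [J] of the squared excesses over [C]. If its infimum were positive, the
    excesses of a near minimizer [u] would serve as weights, and moving [u] slightly towards the
    answer [v] to these weights would push [J] below its infimum. The infimum is only approached,
    hence the slack [e]. *)
Lemma finite_minimax (R : realType) (T : finType) (S : set (T -> R)) (B C : R) :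
  S !=set0 ->
  (forall u, S u -> forall i, 0 <= u i <= B) ->
  (forall u v (a : R), S u -> S v -> 0 <= a <= 1 ->
     exists2 w, S w & forall i, w i <= (1 - a) * u i + a * v i) ->
  (forall q : T -> R, (forall i, 0 <= q i) ->
     exists2 u, S u & \sum_i q i * u i <= C * \sum_i q i) ->
  forall e : R, 0 < e -> exists2 u, S u & forall i, u i <= C + e.
Proof.
move=> [u0 Su0] bS mixS resS e e0.
pose J (u : T -> R) := \sum_i (Num.max (u i - C) 0) ^+ 2.
have J0 u : 0 <= J u by apply: sumr_ge0 => i _; exact: sqr_ge0.
pose A := [set J u | u in S].
have hA : has_inf A.
  by split; [exists (J u0), u0|exists 0 => _ [u _ <-]].
have infA_le u : S u -> inf A <= J u.
  by move=> Su; apply: ge_inf; [exact: hA.2|exists u].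
have infA0 : inf A <= 0.
  rewrite leNgt; apply/negP => I0.
  pose D : R := \sum_(i : T) B ^+ 2 + 1.
  have D0 : 0 < D by rewrite ltr_wpDl// sumr_ge0// => i _; exact: sqr_ge0.
  (* This step length keeps the quadratic error [a ^+ 2 * \sum B ^+ 2] below [a * inf A], while the
     first-order gain is [2 * a * J u], at least [2 * a * inf A]. Starting strictly within
     [a * inf A] of the infimum, the move ends strictly below it. *)
  pose a := Num.min 1 (inf A / D).
  have a0 : 0 < a by rewrite lt_min ltr01 divr_gt0.
  have a1 : a <= 1 by rewrite ge_min lexx.
  have aD : a * D <= inf A by rewrite -ler_pdivlMr// ge_min lexx orbT.
  have [_ [u Su <-] uI] := @inf_adherent _ A (a * inf A) (mulr_gt0 a0 I0) hA.
  have Iu := infA_le _ Su.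
  (* Half the gradient of [J] at [u]; pairing it with [u - C] gives back [J u]. *)
  pose q i := Num.max (u i - C) 0.
  have q0 i : 0 <= q i by rewrite le_max lexx orbT.
  have [v Sv qv] := resS _ q0.
  have [|w Sw wle] := mixS u v a Su Sv; first by rewrite (ltW a0).
  have Jw : J w <= \sum_i (q i ^+ 2 + 2 * a * (q i * (v i - u i)) + a ^+ 2 * B ^+ 2).
    apply: ler_sum => i _.
    have {wle} wi := wle i.
    have d2 : (v i - u i) ^+ 2 <= B ^+ 2.
      have /andP[? ?] := bS _ Su i; have /andP[? ?] := bS _ Sv i.
      by rewrite -subr_ge0 subr_sqr mulr_ge0//; lra.
    have d3 : (a * (v i - u i)) ^+ 2 <= a ^+ 2 * B ^+ 2.
      by rewrite exprMn ler_wpM2l// sqr_ge0.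
    have q1 : u i - C <= q i by rewrite le_max lexx.
    have -> : 2 * a * (q i * (v i - u i)) = 2 * (q i * (a * (v i - u i))) by ring.
    set b := a * (v i - u i) in d3 *.
    have wb : w i - C <= u i - C + b by rewrite /b; lra.
    have [wC|wC] := leP (w i - C) 0.
      rewrite expr0n /=.
      have := sqr_ge0 (q i + b); lra.
    have qb : 0 <= w i - C <= q i + b by lra.
    have : (w i - C) ^+ 2 <= (q i + b) ^+ 2 by rewrite lerXn2r ?nnegrE//; lra.
    lra.
  have qq : \sum_i q i * (v i - u i) <= - J u.
    have -> : \sum_i q i * (v i - u i) =
      (\sum_i q i * v i - C * \sum_i q i) - \sum_i q i * (u i - C).
      rewrite mulr_sumr -!sumrB; apply: eq_bigr => i _; ring.
    have -> : \sum_i q i * (u i - C) = J u.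
      apply: eq_bigr => i _; rewrite /q.
      by case: leP => h; rewrite ?expr0n ?mul0r ?expr2.
    lra.
  rewrite !big_split /= -mulr_sumr -[X in _ + X]mulr_sumr in Jw.
  have DE : a ^+ 2 * (\sum_(i : T) B ^+ 2) <= a * inf A.
    rewrite expr2 -mulrA ler_pM2l//; apply: le_trans aD.
    by rewrite ler_pM2l// /D; lra.
  have := infA_le _ Sw.
  have : 2 * a * \sum_i q i * (v i - u i) <= 2 * a * - J u.
    by rewrite ler_pM2l// mulr_gt0.
  have : a * inf A <= a * J u by rewrite ler_pM2l.
  have JE : \sum_i q i ^+ 2 = J u by [].
  rewrite JE in Jw.
  lra.
have e2 : 0 < e ^+ 2 by rewrite exprn_gt0.
have [_ [u Su <-] uI] := @inf_adherent _ A (e ^+ 2) e2 hA.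
exists u => // i.
have ui : (Num.max (u i - C) 0) ^+ 2 < e ^+ 2.
  apply: (@le_lt_trans _ _ (J u)); last by lra.
  by rewrite /J (bigD1 i)//= lerDl sumr_ge0// => j _; exact: sqr_ge0.
have : Num.max (u i - C) 0 < e.
  by rewrite -(@ltr_pXn2r _ 2)// ?nnegrE ?le_max ?lexx ?orbT// ltW.
rewrite gt_max => /andP[]; lra.
Qed.

(** * Modulus estimates and the cubic cost inequality *)

Section complex_modulus.
Context (R : realType).
Implicit Types z w : R[i].

Lemma normc_ge0 z : 0 <= normc z.
Proof. by case: z => a b; exact: sqrtr_ge0. Qed.

Lemma sqr_normcE z : normc z ^+ 2 = complex.Re z ^+ 2 + complex.Im z ^+ 2.
Proof. by case: z => a b /=; rewrite sqr_sqrtr// addr_ge0// sqr_ge0. Qed.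

Lemma ler_normcD z w : normc (z + w) <= normc z + normc w.
Proof. exact: le_normcD. Qed.

Lemma ler_normcB z w : normc (z - w) <= normc z + normc w.
Proof. by rewrite -(normcN w); exact: le_normcD. Qed.

Lemma normc_Re z : `|complex.Re z| <= normc z.
Proof.
by rewrite -(@ler_pXn2r _ 2)// ?nnegrE ?normc_ge0// sqr_normcE sqr_normr lerDl sqr_ge0.
Qed.

Lemma normc_Im z : `|complex.Im z| <= normc z.
Proof.
by rewrite -(@ler_pXn2r _ 2)// ?nnegrE ?normc_ge0// sqr_normcE sqr_normr lerDr sqr_ge0.
Qed.

Lemma normc_le_ReIm z : normc z <= `|complex.Re z| + `|complex.Im z|.
Proof.
rewrite -(@ler_pXn2r _ 2)// ?nnegrE ?normc_ge0 ?addr_ge0//.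
rewrite sqr_normcE -(sqr_normr (complex.Re z)) -(sqr_normr (complex.Im z)) sqrrD.
by rewrite -addrA lerD2l lerDr mulrn_wge0// mulr_ge0.
Qed.

Lemma normc_real (a : R) : normc a%:C%C = `|a|.
Proof. by rewrite /= expr0n addr0 sqrtr_sqr. Qed.

Lemma ReM z w : complex.Re (z * w) =
  complex.Re z * complex.Re w - complex.Im z * complex.Im w.
Proof. by case: z w => a b [c d]. Qed.

Lemma ImM z w : complex.Im (z * w) =
  complex.Re z * complex.Im w + complex.Im z * complex.Re w.
Proof. by case: z w => a b [c d]. Qed.

Lemma ReD z w : complex.Re (z + w) = complex.Re z + complex.Re w.
Proof. by case: z w => a b [c d]. Qed.

Lemma ImD z w : complex.Im (z + w) = complex.Im z + complex.Im w.
Proof. by case: z w => a b [c d]. Qed.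

Lemma ReN z : complex.Re (- z) = - complex.Re z.
Proof. by case: z => a b. Qed.

Lemma ImN z : complex.Im (- z) = - complex.Im z.
Proof. by case: z => a b. Qed.

Lemma Re_sum (I : Type) (r : seq I) (P : pred I) (F : I -> R[i]) :
  complex.Re (\sum_(i <- r | P i) F i) = \sum_(i <- r | P i) complex.Re (F i).
Proof. exact: (big_morph _ ReD). Qed.

Lemma normc_natr n : normc (n%:R : R[i]) = n%:R.
Proof. by rewrite -[n%:R](rmorph_nat (real_complex R)) normc_real ger0_norm. Qed.

(* [z ^+ 2 * (3 - 2 z)] agrees with [1] to second order at [z = 1] and with [0]
   to second order at [z = 0]. *)
Definition smoothstep z := z ^+ 2 * (3 - 2 * z).

Lemma normc_smoothstep z : normc z <= 1 -> normc (smoothstep z) <= 5.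
Proof.
move=> z1; rewrite /smoothstep !ComplexField.Normc.normcM.
have h : normc (3 - 2 * z) <= 5.
  apply: (le_trans (ler_normcB _ _)).
  by rewrite ComplexField.Normc.normcM !normc_natr; lra.
have := normc_ge0 z; have := normc_ge0 (3 - 2 * z); nra.
Qed.

Lemma Re_ge1_normc z : 1 <= complex.Re z -> 1 <= normc z.
Proof. by move=> h; apply: le_trans (normc_Re z); rewrite ger0_norm; lra. Qed.

Lemma Re_ge1_neq0 z : 1 <= complex.Re z -> z != 0.
Proof. by move=> h; apply/eqP => z0; move: h; rewrite z0 /=; lra. Qed.

Lemma normc_inv_le1 z : 1 <= complex.Re z -> normc z^-1 <= 1.
Proof. by move=> h; rewrite ComplexField.Normc.normcV invf_le1 ?(lt_le_trans ltr01) ?Re_ge1_normc. Qed.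

(** With [z = W^-1] one has [1 - z = s u z], so [q |1 - z|^2] and [t |u|^2 |z|^2] are the same
    quantity. It is at most [q] because [|1 - z| <= 1], and at most [t |u|^2] because [|z| <= 1].
    The double zeros of the cubic bound the two costs by 3 and 5 times this quantity, whence 8. *)
Lemma smoothstep_cost (u : R[i]) (q t v : R) : 0 < q -> 0 < t -> 0 <= v ->
  Num.sqrt v <= complex.Re u ->
  let psi := smoothstep (1 + (Num.sqrt (t / q))%:C%C * u)^-1 in
  q * normc (1 - psi) + t * v * normc psi <= 8 * Num.min q (t * normc u ^+ 2).
Proof.
move=> q0 t0 v0 vu; set s := Num.sqrt (t / q); set W := 1 + _ => /=.
have s0 : 0 <= s by exact: sqrtr_ge0.
have s2 : s ^+ 2 = t / q by rewrite sqr_sqrtr// divr_ge0// ltW.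
have u0 : 0 <= complex.Re u by apply: le_trans vu; exact: sqrtr_ge0.
have W1 : 1 <= complex.Re W by rewrite ReD ReM /= mul0r subr0 lerDl mulr_ge0.
have Wn0 := Re_ge1_neq0 W1.
set z := W^-1.
have z1 : normc z <= 1 by exact: normc_inv_le1.
have zE : 1 - z = s%:C%C * u * z.
  by rewrite /z; apply: (mulIf Wn0); rewrite mulrBl mul1r mulVf// mulfVK// /W addrAC subrr add0r.
have b2 : normc (1 - z) ^+ 2 = t / q * normc u ^+ 2 * normc z ^+ 2.
  by rewrite zE !ComplexField.Normc.normcM normc_real !exprMn sqr_normr s2.
(* [W - 1] is no longer than [W] as soon as [Re W >= 1/2]. *)
have b1 : normc (1 - z) ^+ 2 <= 1.
  have -> : 1 - z = (W - 1) / W by rewrite mulrBl divff// mul1r.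
  rewrite ComplexField.Normc.normcM ComplexField.Normc.normcV exprMn exprVn.
  have W2 : 1 <= normc W ^+ 2 by rewrite exprn_ege1// Re_ge1_normc.
  rewrite ler_pdivrMr ?mul1r; last by lra.
  rewrite !sqr_normcE ReD ImD ReN ImN /=; nra.
have N1 : normc (1 - smoothstep z) <= 3 * normc (1 - z) ^+ 2.
  have -> : 1 - smoothstep z = (1 - z) ^+ 2 * (1 + 2 * z) by rewrite /smoothstep; ring.
  rewrite !ComplexField.Normc.normcM mulrC ler_wpM2r ?mulr_ge0 ?normc_ge0//.
  apply: (le_trans (ler_normcD _ _)).
  by rewrite ComplexField.Normc.normcM !normc_natr ComplexField.Normc.normc1; lra.
have N2 : normc (smoothstep z) <= 5 * normc z ^+ 2.
  rewrite /smoothstep !ComplexField.Normc.normcM mulrC ler_wpM2r ?mulr_ge0 ?normc_ge0//.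
  apply: (le_trans (ler_normcB _ _)).
  by rewrite ComplexField.Normc.normcM !normc_natr; lra.
have vle : v <= normc u ^+ 2.
  rewrite sqr_normcE -(sqr_sqrtr v0); apply: le_trans (_ : complex.Re u ^+ 2 <= _).
    by rewrite lerXn2r ?nnegrE ?sqrtr_ge0.
  by rewrite lerDl sqr_ge0.
set b := normc (1 - z) ^+ 2 in b2 b1 N1 *.
have qb : q * b = t * normc u ^+ 2 * normc z ^+ 2.
  by rewrite b2 -!mulrA mulrCA !mulrA mulfK ?gt_eqF// ?mulrAC//; congr (_ * _); rewrite -!mulrA mulVf ?gt_eqF// mulr1 mulrC.
have z2 : normc z ^+ 2 <= 1 by rewrite expr_le1// normc_ge0.
have z20 : 0 <= normc z ^+ 2 by exact: sqr_ge0.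
have u20 : 0 <= normc u ^+ 2 by exact: sqr_ge0.
apply: (@le_trans _ _ (8 * (q * b))).
  have : q * normc (1 - smoothstep z) <= q * (3 * b) by rewrite ler_pM2l.
  have : t * v * normc (smoothstep z) <= t * v * (5 * normc z ^+ 2).
    by rewrite ler_wpM2l// mulr_ge0// ltW.
  have : t * v * normc z ^+ 2 <= q * b.
    by rewrite qb ler_wpM2r// ler_pM2l.
  lra.
rewrite ler_pM2l// le_min; apply/andP; split.
  by rewrite -[leRHS]mulr1 ler_pM2l.
by rewrite qb -[leRHS]mulr1 ler_wpM2l// mulr_ge0// ltW.
Qed.

End complex_modulus.

(** * Real integrals over the circle *)

Section circle_integral.
Context (R : realType).
Implicit Types (f g h : R -> R).

Definition integrableT f := (mT R).-integrable (Tc R) (EFin \o f).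

Definition intT f : R := \int[mT R]_(x in Tc R) f x.

Definition bddT f := measurable_fun (Tc R) f /\ exists B : R, forall x, `|f x| <= B.

Lemma measurable_Tc : measurable (Tc R).
Proof. exact: measurable_itv. Qed.
Hint Resolve measurable_Tc : core.

(* [R] and the domain [measurableTypeR R] of [lebesgue_measure] carry convertible
   but syntactically distinct measurable structures. *)
Lemma measurable_TcL : measurable (Tc R : set (measurableTypeR R)).
Proof. exact: measurable_Tc. Qed.
Hint Resolve measurable_TcL : core.

Lemma mT_Tc : mT R (Tc R) = 1%E.
Proof. by rewrite /mT /Tc lebesgue_measure_itv/= lte_fin ltr01 oppr0 adde0. Qed.

Lemma integrableT_meas f : integrableT f -> measurable_fun (Tc R) f.
Proof. by move=> /measurable_int /measurable_EFinP. Qed.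

Lemma intTE f : integrableT f -> (\int[mT R]_(x in Tc R) (f x)%:E)%E = (intT f)%:E.
Proof. by move=> h; rewrite /intT /Rintegral fineK// integrable_fin_num. Qed.

Lemma eq_integrableT f g : f =1 g -> integrableT f -> integrableT g.
Proof. by move=> /funext ->. Qed.

Lemma integrableTD f g : integrableT f -> integrableT g ->
  integrableT (fun x => f x + g x).
Proof. by move=> hf hg; have := integrableD measurable_TcL hf hg; exact. Qed.

Lemma integrableTZ (k : R) f : integrableT f -> integrableT (fun x => k * f x).
Proof. by move=> hf; have := integrableZl measurable_TcL k hf; exact. Qed.

Lemma integrableTN f : integrableT f -> integrableT (fun x => - f x).
Proof. by move=> /(integrableTZ (-1)); apply: eq_integrableT => x; rewrite mulN1r. Qed.

Lemma integrableTB f g : integrableT f -> integrableT g ->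
  integrableT (fun x => f x - g x).
Proof. by move=> hf /integrableTN; exact: integrableTD. Qed.

Lemma integrableT_norm f : integrableT f -> integrableT (fun x => `|f x|).
Proof. by move=> hf; have := integrable_abse hf; exact. Qed.

Lemma le_integrableT f g : measurable_fun (Tc R) f -> integrableT g ->
  (forall x, Tc R x -> `|f x| <= g x) -> integrableT f.
Proof.
move=> mf ig fg; apply: (le_integrable measurable_TcL) ig => //.
  exact/measurable_EFinP.
move=> x Tx /=; rewrite lee_fin; apply: le_trans (fg _ Tx) (ler_norm _).
Qed.

Lemma bddT_cst (k : R) : bddT (cst k).
Proof. by split; [exact: measurable_cst|exists `|k|]. Qed.

Lemma bddTD f g : bddT f -> bddT g -> bddT (fun x => f x + g x).
Proof.
move=> [mf [A fA]] [mg [B gB]]; split; first exact: measurable_funD.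
by exists (A + B) => x; rewrite (le_trans (ler_normD _ _))// lerD.
Qed.

Lemma bddTM f g : bddT f -> bddT g -> bddT (fun x => f x * g x).
Proof.
move=> [mf [A fA]] [mg [B gB]]; split; first exact: measurable_funM.
by exists (A * B) => x; rewrite normrM ler_pM.
Qed.

Lemma bddTN f : bddT f -> bddT (fun x => - f x).
Proof.
move=> [mf [A fA]]; split; first exact: measurableT_comp.
by exists A => x; rewrite normrN.
Qed.

Lemma bddTB f g : bddT f -> bddT g -> bddT (fun x => f x - g x).
Proof. by move=> hf /bddTN; exact: bddTD. Qed.

Lemma bddTX f n : bddT f -> bddT (fun x => f x ^+ n).
Proof.
move=> hf; elim: n => [|n IH]; first exact: bddT_cst.
have -> : (fun x => f x ^+ n.+1) = (fun x => f x * f x ^+ n).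
  by apply/funext => x; rewrite exprS.
exact: bddTM.
Qed.

Lemma bddT_sum (I : Type) (r : seq I) (F : I -> R -> R) :
  (forall i, bddT (F i)) -> bddT (fun x => \sum_(i <- r) F i x).
Proof.
move=> hF; elim: r => [|a r IH].
  by rewrite (_ : (fun _ => _) = cst 0); [exact: bddT_cst|apply/funext => x; rewrite big_nil].
rewrite (_ : (fun _ => _) = fun x => F a x + \sum_(i <- r) F i x); first exact: bddTD.
by apply/funext => x; rewrite big_cons.
Qed.

Lemma bddT_integrable f : bddT f -> integrableT f.
Proof.
move=> [mf [B fB]]; apply: measurable_bounded_integrable => //.
  by rewrite [X in (X < _)%E]mT_Tc ltry.
exists B; split; first exact: num_real.
by move=> y By x _; rewrite /= (le_trans (fB _))// ltW.
Qed.

Lemma integrableTM f g : integrableT f -> bddT g -> integrableT (fun x => f x * g x).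
Proof.
move=> iF [mg [B gB]].
apply: (@le_integrableT _ (fun x => B * `|f x|)).
- by apply: measurable_funM => //; exact: integrableT_meas.
- by apply: integrableTZ; exact: integrableT_norm.
- by move=> x _; rewrite normrM mulrC ler_wpM2r.
Qed.

Lemma integrableT_sum (I : Type) (r : seq I) (F : I -> R -> R) :
  (forall i, integrableT (F i)) -> integrableT (fun x => \sum_(i <- r) F i x).
Proof.
move=> hF; elim: r => [|a r IH].
  apply: (@eq_integrableT (cst 0)); first by move=> x; rewrite big_nil.
  exact: bddT_integrable (bddT_cst 0).
apply: (@eq_integrableT (fun x => F a x + \sum_(i <- r) F i x)); last exact: integrableTD.
by move=> x; rewrite big_cons.
Qed.

Lemma intTD f g : integrableT f -> integrableT g ->
  intT (fun x => f x + g x) = intT f + intT g.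
Proof. by move=> hf hg; rewrite /intT RintegralD. Qed.

Lemma intTZ (k : R) f : integrableT f -> intT (fun x => k * f x) = k * intT f.
Proof. by move=> hf; rewrite /intT RintegralZl. Qed.

Lemma intTB f g : integrableT f -> integrableT g ->
  intT (fun x => f x - g x) = intT f - intT g.
Proof. by move=> hf hg; rewrite /intT RintegralB. Qed.

Lemma eq_intT f g : (forall x, Tc R x -> f x = g x) -> intT f = intT g.
Proof. by move=> fg; apply: eq_Rintegral => x /set_mem; exact: fg. Qed.

Lemma intT_cst (k : R) : intT (cst k) = k.
Proof. by rewrite /intT Rintegral_cst// [X in fine X]mT_Tc mulr1. Qed.

Lemma intT_sum (I : Type) (r : seq I) (F : I -> R -> R) :
  (forall i, integrableT (F i)) ->
  intT (fun x => \sum_(i <- r) F i x) = \sum_(i <- r) intT (F i).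
Proof.
move=> hF; elim: r => [|a r IH].
  rewrite big_nil -[RHS](intT_cst 0); apply: eq_intT => x _; by rewrite big_nil.
rewrite big_cons -IH -intTD//; last exact: integrableT_sum.
by apply: eq_intT => x _; rewrite big_cons.
Qed.

Lemma le_intT f g : integrableT f -> integrableT g ->
  (forall x, Tc R x -> f x <= g x) -> intT f <= intT g.
Proof. by move=> hf hg fg; exact: le_Rintegral. Qed.

Lemma intT_ge0 f : (forall x, Tc R x -> 0 <= f x) -> 0 <= intT f.
Proof. by move=> hf; exact: Rintegral_ge0. Qed.

Lemma ae_mT_sub (P Q : R -> Prop) : (forall x, P x -> Q x) ->
  {ae mT R, forall x, P x} -> {ae mT R, forall x, Q x}.
Proof. by move=> PQ; apply: (@filterS _ (almost_everywhere (@lebesgue_measure R)) _). Qed.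

Lemma ae_mT_and (P Q : R -> Prop) : {ae mT R, forall x, P x} ->
  {ae mT R, forall x, Q x} -> {ae mT R, forall x, P x /\ Q x}.
Proof. by move=> p q; apply: (@filterI _ (almost_everywhere (@lebesgue_measure R)) _). Qed.

Lemma ae_mT_foralln (P : nat -> R -> Prop) :
  (forall n, {ae mT R, forall x, P n x}) -> {ae mT R, forall x, forall n, P n x}.
Proof. by move=> h; apply: (@ae_foralln _ _ _ (@lebesgue_measure R)); exact: h. Qed.

Lemma ae_mT_all (P : R -> Prop) : (forall x, P x) -> {ae mT R, forall x, P x}.
Proof. by move=> h; apply: (@filterE _ (almost_everywhere (@lebesgue_measure R)) _). Qed.

Lemma cvg_intT (f_ : nat -> R -> R) f g :
  (forall n, measurable_fun (Tc R) (f_ n)) -> measurable_fun (Tc R) f ->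
  integrableT g -> (forall n x, Tc R x -> `|f_ n x| <= g x) ->
  {ae mT R, forall x, Tc R x -> f_ ^~ x @ \oo --> f x} ->
  integrableT f /\ intT (f_ n) @[n --> \oo] --> intT f.
Proof.
move=> mf_ mf ig fg cf.
have [||||| i1 _ c1] := @dominated_convergence _ _ _ (mT R) _ measurable_TcL
  (fun n => EFin \o f_ n) (EFin \o f) (EFin \o g).
- by move=> n; apply/measurable_EFinP; exact: mf_.
- by apply/measurable_EFinP; exact: mf.
- apply: ae_mT_sub cf => x h Tx; apply/fine_cvgP; split; first by apply: nearW.
  exact: h.
- exact: ig.
- by apply: ae_mT_all => x n Tx /=; rewrite lee_fin fg.
split=> //.
have if_ n : integrableT (f_ n) by exact: le_integrableT ig (fg n).
apply: fine_cvg; rewrite -(intTE i1); exact: c1.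
Qed.

Lemma integrableT_indic f (A : set R) : measurable A -> integrableT f ->
  integrableT (fun x => f x * \1_A x).
Proof.
move=> mA hf; apply: integrableTM => //; split; first exact: measurable_indic.
by exists 1 => x; rewrite indicE; case: (_ \in _); rewrite ?normr1 ?normr0.
Qed.

End circle_integral.
#[global] Hint Resolve measurable_Tc measurable_TcL : core.

(** * Bounded multipliers of H^1 *)

Section hardy_multipliers.
Context (R : realType).
Implicit Types (F G Phi W : R -> R[i]).

Local Notation Re := complex.Re.
Local Notation Im := complex.Im.

Definition cfun_of F : cfun R := (fun x => Re (F x), fun x => Im (F x)).

Definition integrableC F := integrableT (fun x => Re (F x)) /\ integrableT (fun x => Im (F x)).

Definition intC F : R[i] := Complex (intT (fun x => Re (F x))) (intT (fun x => Im (F x))).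

Definition bddC F := bddT (fun x => Re (F x)) /\ bddT (fun x => Im (F x)).

Definition circ (x : R) : R[i] := Complex (cos (2 * pi * x)) (sin (2 * pi * x)).

Lemma circX k x : circ x ^+ k = Complex (cos (2 * pi * k%:R * x)) (sin (2 * pi * k%:R * x)).
Proof.
elim: k => [|k IH]; first by rewrite expr0 mulr0 mul0r cos0 sin0.
rewrite exprS IH /circ -[k.+1]addn1 natrD.
have -> : 2 * pi * (k%:R + 1) * x = 2 * pi * x + 2 * pi * k%:R * x :> R by ring.
rewrite cosD sinD; apply/eqP; rewrite eq_complex /=.
by rewrite eqxx /= addrC.
Qed.

Lemma circD x y : circ (x + y) = circ x * circ y.
Proof.
rewrite /circ mulrDr cosD sinD; apply/eqP; rewrite eq_complex /=.
by rewrite eqxx /= addrC.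
Qed.

Lemma integrableC_normc F : integrableC F -> integrableT (fun x => normc (F x)).
Proof.
move=> [iR iI].
apply: (@le_integrableT _ _ (fun x => `|Re (F x)| + `|Im (F x)|)).
- apply: (@eq_measurable_fun _ _ _ _ (Tc R) (fun x => Num.sqrt (Re (F x) ^+ 2 + Im (F x) ^+ 2))).
    by move=> x _; case: (F x).
  apply: (@measurableT_comp _ _ _ _ _ _ (@Num.sqrt R)).
    by apply: continuous_measurable_fun; exact: sqrt_continuous.
  by apply: measurable_funD; apply: measurable_funX; exact: integrableT_meas.
- by apply: integrableTD; exact: integrableT_norm.
- by move=> x _; rewrite ger0_norm ?normc_ge0//; exact: normc_le_ReIm.
Qed.

Lemma bddC_normc F : bddC F -> exists2 B : R, 1 <= B & forall x, normc (F x) <= B.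
Proof.
move=> [[_ [A hA]] [_ [B hB]]]; exists (1 + (A + B)).
  by rewrite lerDl (le_trans _ (lerD (hA 0) (hB 0)))// addr_ge0.
move=> x; rewrite (le_trans (normc_le_ReIm _))// (le_trans (lerD (hA x) (hB x)))//; lra.
Qed.

Lemma bddC_normcT F : bddC F -> bddT (fun x => normc (F x)).
Proof.
move=> bF; split.
  apply: integrableT_meas; apply: integrableC_normc.
  by split; apply: bddT_integrable; [exact: bF.1|exact: bF.2].
by have [B _ hB] := bddC_normc bF; exists B => x; rewrite ger0_norm ?normc_ge0.
Qed.

Lemma bddC_meas F (B : R) : measurable_fun (Tc R) (fun x => Re (F x)) ->
  measurable_fun (Tc R) (fun x => Im (F x)) -> (forall x, normc (F x) <= B) -> bddC F.
Proof.
move=> mR mI hB; split; split=> //; exists B => x; apply: le_trans (hB x).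
  exact: normc_Re.
exact: normc_Im.
Qed.

Lemma bddC_cst (c : R[i]) : bddC (cst c).
Proof. by split; exact: bddT_cst. Qed.

Lemma bddCD F G : bddC F -> bddC G -> bddC (fun x => F x + G x).
Proof.
move=> [f1 f2] [g1 g2]; split.
  by under eq_fun do rewrite ReD; exact: bddTD.
by under eq_fun do rewrite ImD; exact: bddTD.
Qed.

Lemma bddCN F : bddC F -> bddC (fun x => - F x).
Proof.
move=> [f1 f2]; split.
  by under eq_fun do rewrite ReN; exact: bddTN.
by under eq_fun do rewrite ImN; exact: bddTN.
Qed.

Lemma bddCM F G : bddC F -> bddC G -> bddC (fun x => F x * G x).
Proof.
move=> [f1 f2] [g1 g2]; split.
  by under eq_fun do rewrite ReM; apply: bddTB; exact: bddTM.
by under eq_fun do rewrite ImM; apply: bddTD; exact: bddTM.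
Qed.

Lemma integrableCM F G : integrableC F -> bddC G -> integrableC (fun x => F x * G x).
Proof.
move=> [f1 f2] [g1 g2]; split.
  by under eq_fun do rewrite ReM; apply: integrableTB; exact: integrableTM.
by under eq_fun do rewrite ImM; apply: integrableTD; exact: integrableTM.
Qed.

Lemma integrableCD F G : integrableC F -> integrableC G -> integrableC (fun x => F x + G x).
Proof.
move=> [f1 f2] [g1 g2]; split.
  by under eq_fun do rewrite ReD; exact: integrableTD.
by under eq_fun do rewrite ImD; exact: integrableTD.
Qed.

Lemma intCD F G : integrableC F -> integrableC G ->
  intC (fun x => F x + G x) = intC F + intC G.
Proof.
move=> [f1 f2] [g1 g2]; apply/eqP; rewrite eq_complex /=; apply/andP; split; apply/eqP.
  by under eq_fun do rewrite ReD; exact: intTD.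
by under eq_fun do rewrite ImD; exact: intTD.
Qed.

Lemma intCZ (c : R[i]) F : integrableC F -> intC (fun x => F x * c) = intC F * c.
Proof.
move=> [f1 f2]; apply/eqP; rewrite eq_complex ReM ImM /=; apply/andP; split; apply/eqP.
  under eq_fun do rewrite ReM (mulrC _ (Re c)) (mulrC _ (Im c)).
  by rewrite intTB ?intTZ//; [ring|exact: integrableTZ|exact: integrableTZ].
under eq_fun do rewrite ImM (mulrC _ (Im c)) (mulrC _ (Re c)).
by rewrite intTD ?intTZ//; [ring|exact: integrableTZ|exact: integrableTZ].
Qed.

Lemma bddC_circX k : bddC (fun x => circ x ^+ k).
Proof.
apply: (@bddC_meas _ 1).
- under eq_fun do rewrite circX /=.
  apply: (@measurableT_comp _ _ _ _ _ _ (@cos R)).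
    by apply: continuous_measurable_fun; exact: continuous_cos.
  by apply: measurable_funM => //; exact: measurable_id.
- under eq_fun do rewrite circX /=.
  apply: (@measurableT_comp _ _ _ _ _ _ (@sin R)).
    by apply: continuous_measurable_fun; exact: continuous_sin.
  by apply: measurable_funM => //; exact: measurable_id.
- move=> x; rewrite circX /= cos2Dsin2 sqrtr1//.
Qed.

(** Integrating against [circ x ^+ k] produces the Fourier coefficient of index -k. *)
Definition H1c F := integrableC F /\
  forall k, (0 < k)%N -> intC (fun x => F x * circ x ^+ k) = 0.

Lemma H1cP F : H1 (cfun_of F) <-> H1c F.
Proof.
have nE x : cabs (cfun_of F) x = normc (F x) by rewrite /cabs /=; case: (F x).
have key : integrableC F -> forall k,
    fourier_neg_re (cfun_of F) k = (Re (intC (fun x => F x * circ x ^+ k)))%:E /\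
    fourier_neg_im (cfun_of F) k = (Im (intC (fun x => F x * circ x ^+ k)))%:E.
  move=> iF k; have [i1 i2] := integrableCM iF (bddC_circX k).
  rewrite /= -!intTE//; split; rewrite /fourier_neg_re /fourier_neg_im;
    apply: eq_integral => x _; rewrite circX ?ReM ?ImM//=.
split=> [[[m1 m2 iF] hF]|[[i1 i2] hF]].
  have iFC : integrableC F.
    have iN : integrableT (fun x => normc (F x)).
      by apply: eq_integrable iF => // x _; rewrite nE.
    split; apply: (le_integrableT _ iN) => // x _; [exact: normc_Re|exact: normc_Im].
  split=> // k k0; have [e1 e2] := key iFC k; have [f1 f2] := hF _ k0.
  apply/eqP; rewrite eq_complex /=; apply/andP; split; apply/eqP.
    by move: e1; rewrite f1 => -[].
  by move: e2; rewrite f2 => -[].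
split.
  split; [exact: integrableT_meas i1|exact: integrableT_meas i2|].
  have := integrableC_normc (conj i1 i2).
  by apply: eq_integrable => // x _; rewrite /= nE.
by move=> k k0; have [-> ->] := key (conj i1 i2) k; rewrite hF.
Qed.

(** Bounded analytic functions are represented by their action on H^1. Stability under sums and
    products is then immediate, and each [f_n Psi_n] lies in H^1 by definition. *)
Definition multH1 Phi := bddC Phi /\ forall F, H1c F -> H1c (fun x => F x * Phi x).

Lemma H1cD F G : H1c F -> H1c G -> H1c (fun x => F x + G x).
Proof.
move=> [iF hF] [iG hG]; split; first exact: integrableCD.
move=> k k0; under eq_fun do rewrite mulrDl.
by rewrite intCD ?hF ?hG ?addr0//; apply: integrableCM => //; exact: bddC_circX.
Qed.

Lemma multH1_cst (c : R[i]) : multH1 (cst c).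
Proof.
split; first exact: bddC_cst.
move=> F [iF hF]; split; first by apply: integrableCM => //; exact: bddC_cst.
move=> k k0; under eq_fun do rewrite mulrAC.
by rewrite intCZ ?hF ?mul0r//; apply: integrableCM => //; exact: bddC_circX.
Qed.

Lemma multH1D Phi W : multH1 Phi -> multH1 W -> multH1 (fun x => Phi x + W x).
Proof.
move=> [bP hP] [bW hW]; split; first exact: bddCD.
move=> F hF; under eq_fun do rewrite mulrDr.
by apply: H1cD; [exact: hP|exact: hW].
Qed.

Lemma multH1M Phi W : multH1 Phi -> multH1 W -> multH1 (fun x => Phi x * W x).
Proof.
move=> [bP hP] [bW hW]; split; first exact: bddCM.
by move=> F hF; under eq_fun do rewrite mulrA; exact/hW/hP.
Qed.

Lemma multH1N Phi : multH1 Phi -> multH1 (fun x => - Phi x).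
Proof.
move=> h; rewrite (_ : (fun _ => _) = fun x => cst (-1) x * Phi x).
  by apply: multH1M => //; exact: multH1_cst.
by apply/funext => x; rewrite /= mulN1r.
Qed.

Lemma multH1B Phi W : multH1 Phi -> multH1 W -> multH1 (fun x => Phi x - W x).
Proof. by move=> h /multH1N; exact: multH1D. Qed.

Lemma multH1X Phi n : multH1 Phi -> multH1 (fun x => Phi x ^+ n).
Proof.
move=> h; elim: n => [|n IH]; first exact: (multH1_cst 1).
by under eq_fun do rewrite exprS; exact: multH1M.
Qed.

Lemma multH1_circ : multH1 circ.
Proof.
split; first exact: (bddC_circX 1).
move=> F [iF hF]; split; first by apply: integrableCM => //; exact: (bddC_circX 1).
move=> k k0; under eq_fun do rewrite -mulrA -exprS.
exact: hF.
Qed.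

Lemma multH1_horner (p : {poly R[i]}) : multH1 (fun x => p.[circ x]).
Proof.
elim/poly_ind: p => [|p c IH].
  by under eq_fun do rewrite horner0; exact: multH1_cst.
under eq_fun do rewrite hornerMXaddC.
apply: (@multH1D _ (cst c)); last exact: multH1_cst.
by apply: multH1M => //; exact: multH1_circ.
Qed.

Definition cvgC (u : nat -> R[i]) (l : R[i]) :=
  Re (u n) @[n --> \oo] --> Re l /\ Im (u n) @[n --> \oo] --> Im l.

Lemma cvgC_mull (u : nat -> R[i]) l a : cvgC u l -> cvgC (fun n => a * u n) (a * l).
Proof.
move=> [h1 h2]; split.
  rewrite ReM; under eq_fun do rewrite ReM.
  by apply: cvgB; apply: cvgM => //; exact: cvg_cst.
rewrite ImM; under eq_fun do rewrite ImM.
by apply: cvgD; apply: cvgM => //; exact: cvg_cst.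
Qed.

Lemma cvgC_normcB (u : nat -> R[i]) l :
  normc (l - u n) @[n --> \oo] --> (0 : R) -> cvgC u l.
Proof.
move=> h; split; apply/cvgrPdist_le => e e0;
  move/cvgrPdist_le : h => /(_ _ e0); apply: filterS => n;
  rewrite sub0r normrN [X in X <= _ -> _]ger0_norm ?normc_ge0//; apply: le_trans.
  by rewrite -ReN -ReD normc_Re.
by rewrite -ImN -ImD normc_Im.
Qed.

Lemma cvgC_normc (u : nat -> R[i]) l : cvgC u l -> normc (u n) @[n --> \oo] --> normc l.
Proof.
move=> [h1 h2].
have -> : (fun n => normc (u n)) = (fun n => Num.sqrt (Re (u n) ^+ 2 + Im (u n) ^+ 2)).
  by apply/funext => n; case: (u n).
have -> : normc l = Num.sqrt (Re l ^+ 2 + Im l ^+ 2) by case: (l).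
have h : Re (u n) ^+ 2 + Im (u n) ^+ 2 @[n --> \oo] --> Re l ^+ 2 + Im l ^+ 2.
  by apply: cvgD; apply: cvgM.
exact: (cvg_comp _ _ h (@sqrt_continuous R _)).
Qed.

Lemma cvg_intC (F_ : nat -> R -> R[i]) F (g : R -> R) :
  (forall n, integrableC (F_ n)) -> integrableC F ->
  integrableT g -> (forall n x, Tc R x -> normc (F_ n x) <= g x) ->
  {ae mT R, forall x, Tc R x -> cvgC (F_ ^~ x) (F x)} ->
  cvgC (fun n => intC (F_ n)) (intC F).
Proof.
move=> i_ iF ig hg cF; split=> /=.
  apply: (proj2 (@cvg_intT _ (fun n x => Re (F_ n x)) (fun x => Re (F x)) g _ _ ig _ _)).
  - by move=> n; exact: integrableT_meas (i_ n).1.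
  - exact: integrableT_meas iF.1.
  - by move=> n x Tx; apply: le_trans (hg n x Tx); exact: normc_Re.
  - by apply: ae_mT_sub cF => x h Tx; exact: (h Tx).1.
apply: (proj2 (@cvg_intT _ (fun n x => Im (F_ n x)) (fun x => Im (F x)) g _ _ ig _ _)).
- by move=> n; exact: integrableT_meas (i_ n).2.
- exact: integrableT_meas iF.2.
- by move=> n x Tx; apply: le_trans (hg n x Tx); exact: normc_Im.
- by apply: ae_mT_sub cF => x h Tx; exact: (h Tx).2.
Qed.

(** The integrals that must vanish pass to the limit by dominated convergence, with majorant
    [B |F|]. *)
Lemma multH1_lim (Phi_ : nat -> R -> R[i]) Phi (B : R) :
  (forall n, multH1 (Phi_ n)) -> (forall n x, normc (Phi_ n x) <= B) -> bddC Phi ->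
  {ae mT R, forall x, Tc R x -> cvgC (Phi_ ^~ x) (Phi x)} -> multH1 Phi.
Proof.
move=> h_ hB bP cP; split=> // F hF; have [iF _] := hF.
split; first exact: integrableCM.
move=> k k0.
have bk := bddC_circX k.
pose F' n x := F x * Phi_ n x * circ x ^+ k.
have [//|||||h1 h2] := @cvg_intC F'
  (fun x => F x * Phi x * circ x ^+ k) (fun x => B * normc (F x)).
- move=> n; apply: integrableCM => //; apply: integrableCM => //; exact: (h_ n).1.
- by apply: integrableCM => //; exact: integrableCM.
- by apply: integrableTZ; exact: integrableC_normc.
- move=> n x _; rewrite !ComplexField.Normc.normcM.
  have -> : normc (circ x ^+ k) = 1 by rewrite circX /= cos2Dsin2 sqrtr1.
  by rewrite mulr1 mulrC ler_wpM2r ?normc_ge0.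
- apply: ae_mT_sub cP => x h Tx.
  have := cvgC_mull (F x * circ x ^+ k) (h Tx).
  rewrite mulrAC; congr cvgC; apply/funext => n; exact: mulrAC.
have z n : intC (F' n) = 0 by apply: ((h_ n).2 _ hF).2.
apply/eqP; rewrite eq_complex; apply/andP; split; apply/eqP.
  have e1 : (fun n => Re (intC (F' n))) = cst 0 by apply/funext => n; rewrite z.
  by have := cvg_lim (@Rhausdorff R) h1; rewrite e1 lim_cst// => <-.
have e2 : (fun n => Im (intC (F' n))) = cst 0 by apply/funext => n; rewrite z.
by have := cvg_lim (@Rhausdorff R) h2; rewrite e2 lim_cst// => <-.
Qed.

(* The inverse is the limit of the Richardson iteration
   [P_(n+1) = P_n + (1 - W P_n) / B^2], whose error is multiplied at each step
   by [1 - W / B^2], of squared modulus at most [1 - 1 / B^2]. *)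
Lemma multH1_inv W : multH1 W -> (forall x, 1 <= Re (W x)) ->
  multH1 (fun x => (W x)^-1).
Proof.
move=> mW W1; have [B B1 WB] := bddC_normc mW.1.
pose c : R := B ^+ 2.
have c1 : 1 <= c by rewrite exprn_ege1.
pose P n x : R[i] := iter n (fun p => p + (1 - W x * p) * (c^-1)%:C%C) 0.
have mP n : multH1 (P n).
  elim: n => [|n IH]; first exact: (multH1_cst 0).
  apply: multH1D => //; apply: multH1M; last exact: multH1_cst.
  by apply: multH1B; [exact: (multH1_cst 1)|exact: multH1M].
have cc : (c%:C)%C * (c^-1)%:C%C = 1 :> R[i] by rewrite -rmorphM /= divff//; lra.
have err n x : (W x)^-1 - P n x = (W x)^-1 * (1 - W x * (c^-1)%:C%C) ^+ n.
  have Wn0 := Re_ge1_neq0 (W1 x).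
  elim: n => [|n IH]; first by rewrite expr0 mulr1 subr0.
  rewrite exprSr mulrA -IH.
  have -> : P n.+1 x = P n x + (1 - W x * P n x) * (c^-1)%:C%C by [].
  have -> : (W x)^-1 - (P n x + (1 - W x * P n x) * (c^-1)%:C%C) =
    ((W x)^-1 - P n x) * (1 - W x * (c^-1)%:C%C) + (W x * (W x)^-1 - 1) * (c^-1)%:C%C by ring.
  by rewrite divff// subrr mul0r addr0.
pose r : R := 1 - c^-1.
have cV : 0 < c^-1 <= 1 by rewrite invr_gt0 invf_le1; lra.
have r01 : 0 <= r < 1 by rewrite /r; lra.
(* Expanding the square, [Re W >= 1] contributes at most [- 2 / c] and [|W|^2 <= c] at most
   [1 / c]. *)
have q2 x : normc (1 - W x * (c^-1)%:C%C) ^+ 2 <= r.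
  have : normc (W x) ^+ 2 <= c by rewrite lerXn2r ?nnegrE ?normc_ge0//; lra.
  rewrite !sqr_normcE ReD ImD ReN ImN ReM ImM /= !mulr0 subr0 add0r.
  have := W1 x; set a := Re _; set b := Im _ => a1 ab.
  have : (a ^+ 2 + b ^+ 2) * c^-1 ^+ 2 <= c^-1.
    have abc : (a ^+ 2 + b ^+ 2) * c^-1 <= 1 by rewrite ler_pdivrMr; lra.
    by rewrite expr2 mulrA; apply: ler_piMl => //; lra.
  rewrite /r; set d := c^-1 in cV *; nra.
have errle n x : normc ((W x)^-1 - P n x) ^+ 2 <= r ^+ n.
  rewrite err ComplexField.Normc.normcM exprMn.
  have -> : normc ((1 - W x * (c^-1)%:C%C) ^+ n) ^+ 2 = (normc (1 - W x * (c^-1)%:C%C) ^+ 2) ^+ n.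
    rewrite exprAC; congr (_ ^+ 2).
    elim: (n) => [|m IH]; first by rewrite !expr0 ComplexField.Normc.normc1.
    by rewrite !exprS ComplexField.Normc.normcM IH.
  rewrite -[leRHS]mul1r; apply: ler_pM.
  - exact: sqr_ge0.
  - by apply: exprn_ge0; exact: sqr_ge0.
  - by rewrite exprn_ile1 ?normc_ge0// normc_inv_le1.
  - by rewrite lerXn2r ?nnegrE ?sqr_ge0//; case/andP: r01.
have cP x : cvgC (P ^~ x) (W x)^-1.
  apply: cvgC_normcB.
  have h : normc ((W x)^-1 - P n x) ^+ 2 @[n --> \oo] --> (0 : R).
    apply: (@squeeze_cvgr _ _ _ _ (cst 0) (fun n => r ^+ n)).
    - by apply: nearW => n; rewrite sqr_ge0 errle.
    - exact: cvg_cst.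
    - by apply: cvg_expr; rewrite ger0_norm; case/andP: r01.
  have sE : (fun n => normc ((W x)^-1 - P n x)) =
      Num.sqrt \o (fun n => normc ((W x)^-1 - P n x) ^+ 2).
    by apply/funext => n /=; rewrite sqrtr_sqr ger0_norm ?normc_ge0.
  by rewrite sE -sqrtr0; exact: (cvg_comp _ _ h (@sqrt_continuous R _)).
apply: (@multH1_lim P _ 2) => //.
- move=> n x.
  have -> : P n x = (W x)^-1 - ((W x)^-1 - P n x) by rewrite opprB addrC subrK.
  apply: (le_trans (ler_normcB _ _)); apply: lerD; first exact: normc_inv_le1.
  rewrite -(@ler_pXn2r _ 2) ?nnegrE ?normc_ge0// expr1n (le_trans (errle _ _))//.
  by rewrite exprn_ile1; case/andP: r01 => // ? /ltW.
(* Measurability of the inverse is inherited from the iterates, which converge to it at every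
   point. *)
- apply: (@bddC_meas _ 1).
  + apply: (@measurable_fun_cvg _ _ _ _ (fun n x => Re (P n x))).
      by move=> n; exact: (mP n).1.1.1.
    by move=> x _; exact: (cP x).1.
  + apply: (@measurable_fun_cvg _ _ _ _ (fun n x => Im (P n x))).
      by move=> n; exact: (mP n).1.2.1.
    by move=> x _; exact: (cP x).2.
  + by move=> x; exact: normc_inv_le1.
- by apply: ae_mT_all => x _; exact: cP.
Qed.

Lemma multH1_smoothstep Phi : multH1 Phi -> multH1 (fun x => smoothstep (Phi x)).
Proof.
move=> h; apply: multH1M; first exact: multH1X.
apply: multH1B; first exact: (multH1_cst 3).
by apply: multH1M => //; exact: (multH1_cst 2).
Qed.

End hardy_multipliers.

(** * Analytic Fejer kernels and the majorant [U] *)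

Section fejer_majorant.
Context (R : realType).

Local Notation Re := complex.Re.
Local Notation Im := complex.Im.
Local Notation circ := (@circ R).

Lemma is_derive_scale (f : R -> R) (c x df : R) : c != 0 ->
  is_derive (c * x) (1 : R) f df -> is_derive x (1 : R) (fun y => f (c * y) / c) df.
Proof.
move=> c0 hf.
have h1 : is_derive x (1 : R) (fun y => c * y) c.
  have := @is_deriveZ R R R (fun y => y) c x 1 1 _.
  rewrite /GRing.scale /= mulr1; exact.
have := @is_deriveZ R R R (f \o (fun y => c * y)) c^-1 x 1 _ (is_derive1_comp hf h1).
rewrite /GRing.scale /= mulrA mulrAC mulVf// mul1r.
have -> : (fun y : R => f (c * y) / c) = (c^-1 \*: (f \o (fun y => c * y))).
  by apply: funext => y /=; rewrite mulrC.
exact.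
Qed.

Lemma intT_FTC2 (f F : R -> R) : continuous f ->
  (forall x : R, is_derive x (1 : R) F (f x)) -> intT f = F 1 - F 0.
Proof.
move=> cf dF; rewrite /intT /Rintegral integral_itv_bndo_bndc; last first.
  by apply/measurable_EFinP; apply: measurable_funTS; exact: continuous_measurable_fun.
have dvF x : derivable F x 1 by have := dF x; case.
have cF : continuous F.
  by move=> x; apply: differentiable_continuous; exact/derivable1_diffP.
rewrite (@continuous_FTC2 _ f F)//.
- by apply: continuous_subspaceT.
- split=> //.
  + by apply: cvg_at_right_filter; exact: cF.
  + by apply: cvg_at_left_filter; exact: cF.
- by move=> x _; rewrite derive1E; have := dF x; case.
Qed.

Lemma H1c_cst1 : H1c (cst (1 : R[i])).
Proof.
split.
  by split; apply: bddT_integrable; exact: bddT_cst.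
move=> k k0; under eq_fun do rewrite mul1r circX.
have c0 : 2 * pi * k%:R != 0 :> R.
  by rewrite gt_eqF// mulr_gt0 ?ltr0n// mulr_gt0// pi_gt0.
have per : sin (2 * pi * k%:R) = 0 :> R /\ cos (2 * pi * k%:R) = 1 :> R.
  have -> : 2 * pi * k%:R = 0 + pi *+ 2 *+ k :> R.
    by rewrite add0r -mulrnA -[RHS]mulr_natr natrM; ring.
  elim: (k) => [|n [IHs IHc]]; first by rewrite mulr0n addr0 sin0 cos0.
  by rewrite mulrSr addrA sinD2pi cosD2pi IHs IHc.
apply/eqP; rewrite eq_complex /=; apply/andP; split; apply/eqP.
  have ds x : is_derive x (1 : R) (fun y => sin (2 * pi * k%:R * y) / (2 * pi * k%:R))
      (cos (2 * pi * k%:R * x)) by apply: is_derive_scale => //; exact: is_derive_sin.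
  rewrite (intT_FTC2 _ ds); first by rewrite mulr1 mulr0 sin0 per.1 !mul0r subr0.
  move=> x; apply: continuous_comp; first exact: mulrl_continuous.
  exact: continuous_cos.
have dc x : is_derive x (1 : R) (fun y => - cos (2 * pi * k%:R * y) / (2 * pi * k%:R))
    (sin (2 * pi * k%:R * x)).
  apply: (@is_derive_scale (fun y => - cos y)) => //.
  rewrite -[sin _]opprK; apply: is_deriveN.
rewrite (intT_FTC2 _ dc); first by rewrite mulr1 mulr0 cos0 per.2 subrr.
move=> x; apply: continuous_comp; first exact: mulrl_continuous.
exact: continuous_sin.
Qed.

Lemma bddC_integrable (F : R -> R[i]) : bddC F -> integrableC F.
Proof. by move=> [h1 h2]; split; exact: bddT_integrable. Qed.

(** Mean value property at the origin: everything but the constant term is [circ] times a multiplier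
    applied to the constant 1, and the integral of that is a vanishing coefficient. *)
Lemma intC_horner (p : {poly R[i]}) : intC (fun x => p.[circ x]) = p.[0].
Proof.
elim/poly_ind: p => [|p c _].
  under eq_fun do rewrite horner0.
  by rewrite horner0 /intC /=; rewrite (intT_cst 0).
under eq_fun do rewrite hornerMXaddC.
rewrite hornerMXaddC mulr0 add0r.
have mp := multH1_horner p.
rewrite (@intCD _ _ (cst c)).
- have [_ h] := mp.2 _ H1c_cst1; have := h 1%N isT.
  under eq_fun do rewrite mul1r expr1.
  move=> ->; rewrite add0r /intC.
  by rewrite (intT_cst (Re c)) (intT_cst (Im c)); case: (c).
- by apply: bddC_integrable; apply: bddCM; [exact: mp.1|exact: (bddC_circX R 1)].
- by apply: bddC_integrable; exact: bddC_cst.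
Qed.

(** [|j - k|]: one of the two truncated differences is always 0. *)
Definition natdist (j k : nat) : nat := ((j - k) + (k - j))%N.

Lemma Re_circ_natdist (j k : nat) (y : R) : Re (circ y ^+ natdist j k) =
  cos (2 * pi * j%:R * y) * cos (2 * pi * k%:R * y) +
  sin (2 * pi * j%:R * y) * sin (2 * pi * k%:R * y).
Proof.
rewrite circX /= -cosB /natdist; have [jk|/ltnW jk] := leqP j k.
  have /eqP -> : (j - k == 0)%N by rewrite subn_eq0.
  rewrite add0n natrB// -cosN; congr cos; ring.
have /eqP -> : (k - j == 0)%N by rewrite subn_eq0.
rewrite addn0 natrB//; congr cos; ring.
Qed.

(** The Fejer kernel with each exponent [j - k] replaced by [|j - k|]. On the circle the real part
    is unchanged, hence nonnegative, while the function becomes a polynomial in [w]. *)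
Definition fejerC (M : nat) (w : R[i]) : R[i] :=
  (M%:R^-1)%:C%C * \sum_(j < M) \sum_(k < M) w ^+ natdist j k.

Definition fejer (M : nat) (y : R) : R := Re (fejerC M (circ y)).

Lemma fejerE M y : fejer M y = M%:R^-1 *
  ((\sum_(j < M) cos (2 * pi * j%:R * y)) ^+ 2 +
   (\sum_(j < M) sin (2 * pi * j%:R * y)) ^+ 2).
Proof.
rewrite /fejer /fejerC ReM /= mul0r subr0 Re_sum; congr (_ * _).
rewrite !expr2 !mulr_suml -big_split /=; apply: eq_bigr => j _.
rewrite Re_sum !mulr_sumr -big_split /=; apply: eq_bigr => k _.
exact: Re_circ_natdist.
Qed.

Lemma fejer_ge0 M y : 0 <= fejer M y.
Proof. by rewrite fejerE mulr_ge0// addr_ge0// sqr_ge0. Qed.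

Lemma cos_ge_half (a : R) : `|a| <= pi / 4 -> 2^-1 <= cos a.
Proof.
move=> ha; have pi0 := pi_gt0 R.
have c1 : 0 <= cos a by apply: cos_ge0_pihalf; move: ha; rewrite ler_norml => /andP[h1 h2]; lra.
have : 0 <= cos (a *+ 2).
  by apply: cos_ge0_pihalf; move: ha; rewrite ler_norml => /andP[h1 h2]; lra.
rewrite cos_mulr2n => h.
by rewrite -(@ler_pXn2r _ 2) ?nnegrE//; lra.
Qed.

(** All angles involved are at most pi/4, so the [M] cosines are at least 1/2 and contribute
    [(M / 2)^2 / M]. The radius [1 / (8 M)] is half the length of an arc when the circle is cut into
    [4 * M] arcs, which is where that number of arcs comes from. *)
Lemma fejer_lower M y : (0 < M)%N -> `|y| <= (8 * M%:R)^-1 -> M%:R / 4 <= fejer M y.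
Proof.
move=> M0 hy; have M0' : 0 < M%:R :> R by rewrite ltr0n.
rewrite fejerE ler_pdivlMl//.
apply: (@le_trans _ _ ((\sum_(j < M) cos (2 * pi * j%:R * y)) ^+ 2)); last first.
  by rewrite lerDl sqr_ge0.
have h : M%:R / 2 <= \sum_(j < M) cos (2 * pi * j%:R * y).
  rewrite (_ : M%:R / 2 = \sum_(j < M) 2^-1); last by rewrite sumr_const card_ord mulr_natl.
  apply: ler_sum => j _; apply: cos_ge_half.
  rewrite !normrM (ger0_norm (pi_ge0 R)) !normr_nat.
  have jM : j%:R <= M%:R :> R by rewrite ler_nat ltnW.
  apply: (@le_trans _ _ (2 * pi * M%:R * (8 * M%:R)^-1)).
    have h1 : 2 * pi * j%:R <= 2 * pi * M%:R :> R by rewrite ler_wpM2l// mulr_ge0 ?pi_ge0.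
    by apply: ler_pM => //; rewrite !mulr_ge0 ?pi_ge0.
  by rewrite le_eqVlt; apply/orP; left; apply/eqP; field; rewrite gt_eqF.
have : (M%:R / 2) ^+ 2 <= (\sum_(j < M) cos (2 * pi * j%:R * y)) ^+ 2.
  by rewrite lerXn2r ?nnegrE//; apply: le_trans h; lra.
apply: le_trans; lra.
Qed.

Lemma circ_natN n : circ (- n%:R) = 1.
Proof.
have -> : circ (- n%:R) = circ (- 1) ^+ n.
  elim: n => [|n IH]; first by rewrite oppr0 expr0 /circ mulr0 cos0 sin0.
  by rewrite exprS -IH -circD; congr circ; rewrite -[n.+1]addn1 natrD; ring.
rewrite [circ (-1)](_ : _ = 1) ?expr1n//.
rewrite /circ mulrN1 cosN sinN.
have -> : 2 * pi = 0 + pi *+ 2 :> R by rewrite add0r mulr2n; ring.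
by rewrite cosD2pi sinD2pi cos0 sin0 oppr0.
Qed.

Lemma circ_neq1 (a : R) : 0 < a < 1 -> circ (- a) != 1.
Proof.
move=> a01; rewrite /circ eq_complex /= mulrN cosN; apply/negP => /andP[/eqP h _].
have pi0 := pi_gt0 R.
have : 0 < sin (pi * a).
  apply: sin_gt0_pi; apply/andP; split; first by rewrite mulr_gt0//; lra.
  by rewrite -[ltRHS]mulr1 ltr_pM2l//; lra.
have : cos (pi * a *+ 2) = 1 by rewrite -h; congr cos; rewrite mulr2n; ring.
rewrite cos_mulr2n -[cos _ ^+ 2](addrK (sin (pi * a) ^+ 2)) cos2Dsin2 => e s0.
have : sin (pi * a) ^+ 2 = 0 by lra.
by move/eqP; rewrite sqrf_eq0 gt_eqF.
Qed.

(** A geometric sum whose ratio is an [L]-th root of unity, different from 1 because [0 < d < L]. *)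
Lemma sum_circ_shift (L d : nat) (x : R) : (0 < d < L)%N ->
  \sum_(i < L) circ (x - (i%:R + 2^-1) / L%:R) ^+ d = 0.
Proof.
move=> /andP[d0 dL]; have L0 : 0 < L%:R :> R by rewrite ltr0n (leq_ltn_trans _ dL).
pose z := circ (- (d%:R / L%:R)).
have circMn (y : R) n : circ y ^+ n = circ (n%:R * y).
  by rewrite circX /circ !mulrA.
have E i : circ (x - (i%:R + 2^-1) / L%:R) ^+ d = circ (d%:R * (x - 2^-1 / L%:R)) * z ^+ i.
  by rewrite /z !circMn -circD; congr circ; field; rewrite gt_eqF.
under eq_bigr do rewrite E.
rewrite -mulr_sumr; set S := \sum_(_ < _) _.
have z1 : z != 1.
  apply: circ_neq1; apply/andP; split; first by rewrite divr_gt0// ltr0n.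
  by rewrite ltr_pdivrMr// mul1r ltr_nat.
have zL : z ^+ L = 1.
  by rewrite /z circMn mulrN mulrC mulfVK ?gt_eqF// circ_natN.
have : (z - 1) * S = 0 by rewrite -subrX1 zL subrr.
by move/eqP; rewrite mulf_eq0 subr_eq0 (negbTE z1) /= => /eqP ->; rewrite mulr0.
Qed.

Lemma natdist_lt j k M : (j < M)%N -> (k < M)%N -> (natdist j k < M)%N.
Proof. by rewrite /natdist; lia. Qed.

Lemma natdist_eq0 j k : (natdist j k == 0)%N = (j == k).
Proof. by rewrite /natdist; lia. Qed.

(** The exponents stay below the number of nodes, so summing over the nodes kills every term with
    [j != k]. The translates thus form an exact partition of the constant [4 * M]. *)
Lemma sum_fejer (M : nat) (x : R) : (0 < M)%N ->
  \sum_(i < 4 * M) fejer M (x - (i%:R + 2^-1) / (4 * M)%:R) = (4 * M)%:R.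
Proof.
move=> M0; rewrite /fejer -Re_sum /fejerC -mulr_sumr exchange_big /=.
have E j k : (j < M)%N -> (k < M)%N ->
  \sum_(i < 4 * M) circ (x - (i%:R + 2^-1) / (4 * M)%:R) ^+ natdist j k =
  ((4 * M)%:R *+ (j == k)).
  move=> jM kM; have [jk|jk] := eqVneq j k.
    have /eqP -> : natdist j k == 0%N by rewrite natdist_eq0 jk.
    by under eq_bigr do rewrite expr0; rewrite sumr_const card_ord mulr1n.
  rewrite mulr0n sum_circ_shift// lt0n natdist_eq0 jk /=.
  by apply: (leq_trans (natdist_lt jM kM)); rewrite leq_pmull.
have -> : \sum_(j < M) \sum_(i < 4 * M) \sum_(k < M)
    circ (x - (i%:R + 2^-1) / (4 * M)%:R) ^+ natdist j k = \sum_(j < M) (4 * M)%:R.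
  apply: eq_bigr => j _; rewrite exchange_big /=.
  rewrite (bigD1 j)//= E// eqxx mulr1n big1 ?addr0// => k kj.
  by rewrite -val_eqE /= in kj; rewrite E// eq_sym (negbTE kj).
rewrite sumr_const card_ord -mulrnA -(rmorph_nat (real_complex R)) -rmorphM /=.
by rewrite [(_ * M)%:R]natrM mulrCA mulVf ?mulr1// pnatr_eq0 -lt0n.
Qed.

Definition arc (L i : nat) : set R := `[i%:R / L%:R, (i.+1)%:R / L%:R[.

(** [U] is a nonnegative combination of kernels centred at the midpoints of the arcs. On each arc
    the kernel centred there already gives the lower bound. For the integral, the real part is
    handled by convexity of the square and the imaginary part by the mean value property of
    [U^2]. *)
Lemma fejer_majorant (M : nat) (lam : 'I_(4 * M) -> R) : (0 < M)%N ->
  (forall i, 0 <= lam i) ->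
  exists U : R -> R[i], [/\ multH1 U, forall x, 0 <= Re (U x),
    forall (i : 'I_(4 * M)) x, arc (4 * M) i x -> Num.sqrt (lam i) <= Re (U x) &
    intT (fun x => normc (U x) ^+ 2) <= 512 * (\sum_i lam i) / (4 * M)%:R].
Proof.
move=> M0 lam0; set L := (4 * M)%N.
have M0' : 0 < M%:R :> R by rewrite ltr0n.
have L4 : L%:R = 4 * M%:R :> R by rewrite natrM.
have L0 : 0 < L%:R :> R by rewrite L4 mulr_gt0.
pose xi (i : 'I_L) : R := (i%:R + 2^-1) / L%:R.
(* Chosen so that [c i] times the lower bound [M / 4] of the kernel is [sqrt (lam i)]. *)
pose c i : R := 4 * Num.sqrt (lam i) / M%:R.
have c0 i : 0 <= c i by rewrite /c !mulr_ge0 ?sqrtr_ge0// invr_ge0 ltW.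
(* The kernel rotated to the midpoint [xi i], kept as a polynomial so that its mean is its value at
   0. *)
pose V (i : 'I_L) : {poly R[i]} := ((M%:R^-1)%:C%C)%:P *
  \sum_(j < M) \sum_(k < M) ((circ (- xi i))%:P * 'X) ^+ natdist j k.
have VE i w : (V i).[w] = fejerC M (w * circ (- xi i)).
  rewrite /V hornerM hornerC horner_sum; congr (_ * _); apply: eq_bigr => j _.
  rewrite horner_sum; apply: eq_bigr => k _.
  by rewrite horner_exp hornerM hornerC hornerX mulrC.
have V0 i : (V i).[0] = 1.
  rewrite VE mul0r /fejerC.
  have -> : \sum_(j < M) \sum_(k < M) (0 : R[i]) ^+ natdist j k = \sum_(j < M) 1.
    apply: eq_bigr => j _; rewrite (bigD1 j)//= expr0n natdist_eq0 eqxx big1 ?addr0// => k kj.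
    by rewrite expr0n natdist_eq0 eq_sym val_eqE (negbTE kj).
  rewrite sumr_const card_ord -(rmorph_nat (real_complex R)) -rmorphM /=.
  by rewrite mulVf// gt_eqF.
pose p : {poly R[i]} := \sum_i ((c i)%:C%C)%:P * V i.
pose U x := p.[circ x].
have UE x : U x = \sum_i (c i)%:C%C * (V i).[circ x].
  by rewrite /U /p horner_sum; apply: eq_bigr => i _; rewrite hornerM hornerC.
have ReU x : Re (U x) = \sum_i c i * fejer M (x - xi i).
  rewrite UE Re_sum; apply: eq_bigr => i _.
  by rewrite ReM /= mul0r subr0 VE -circD.
have p0 : p.[0] = (\sum_i c i)%:C%C.
  rewrite /p horner_sum rmorph_sum; apply: eq_bigr => i _.
  by rewrite hornerM hornerC V0 mulr1.
have mU : multH1 U by exact: multH1_horner.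
have [bR bI] := mU.1.
exists U; split=> //.
- by move=> x; rewrite ReU sumr_ge0// => i _; rewrite mulr_ge0// fejer_ge0.
- move=> i x; rewrite /arc /= in_itv /= => /andP[x1 x2].
  rewrite ReU (bigD1 i)//=.
  apply: (@le_trans _ _ (c i * fejer M (x - xi i))); last first.
    by rewrite lerDl sumr_ge0// => j _; rewrite mulr_ge0// fejer_ge0.
  have K : M%:R / 4 <= fejer M (x - xi i).
    apply: fejer_lower => //; rewrite /xi.
    have e1 : (i%:R + 2^-1) / L%:R = i%:R / L%:R + (8 * M%:R)^-1 :> R.
      by rewrite L4; field; rewrite gt_eqF.
    have e2 : (i.+1)%:R / L%:R = i%:R / L%:R + 2 * (8 * M%:R)^-1 :> R.
      by rewrite -[i.+1]addn1 natrD L4; field; rewrite gt_eqF.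
    rewrite e1 ler_norml; move: x2; rewrite e2; lra.
  apply: (le_trans _ (ler_wpM2l (c0 i) K)).
  rewrite /c le_eqVlt; apply/orP; left; apply/eqP; field; exact: lt0r_neq0.
(* Cauchy-Schwarz in variance form: the kernel values are weights of total mass [L], and [m] is the
   weighted mean of the [c i]. *)
- have Re2 x : Re (U x) ^+ 2 <= L%:R * \sum_i c i ^+ 2 * fejer M (x - xi i).
    have sK := sum_fejer x M0; rewrite -/L in sK.
    pose m := Re (U x) / L%:R.
    have : 0 <= \sum_i fejer M (x - xi i) * (c i - m) ^+ 2.
      by apply: sumr_ge0 => i _; rewrite mulr_ge0 ?fejer_ge0// sqr_ge0.
    have -> : \sum_i fejer M (x - xi i) * (c i - m) ^+ 2 =
        \sum_i c i ^+ 2 * fejer M (x - xi i) - 2 * m * Re (U x) + m ^+ 2 * L%:R.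
      rewrite ReU -sK !mulr_sumr -sumrB -big_split /=; apply: eq_bigr => i _; ring.
    have -> : m ^+ 2 * L%:R = m * Re (U x).
      by rewrite /m; field; rewrite gt_eqF.
    rewrite -ler_pdivrMl// => h.
    have -> : L%:R^-1 * Re (U x) ^+ 2 = m * Re (U x) by rewrite /m expr2 mulrA [_^-1 * _]mulrC.
    lra.
  have iK i : integrableT (fun x => fejer M (x - xi i)) /\ intT (fun x => fejer M (x - xi i)) = 1.
    have e : (fun x => fejer M (x - xi i)) = (fun x => Re (V i).[circ x]).
      by apply/funext => x; rewrite VE -circD.
    rewrite e; split; first by apply: bddT_integrable; exact: (multH1_horner (V i)).1.1.
    by have := intC_horner (V i); rewrite V0 => -[].
  have b2 : bddT (fun x => Re (U x) ^+ 2) by exact: bddTX.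
  have b3 : bddT (fun x => Im (U x) ^+ 2) by exact: bddTX.
  (* The mean of [U^2] is [U^2] at the origin, the square of a real number, so
     [int (Re U)^2 - int (Im U)^2] is nonnegative. *)
  have ImRe : intT (fun x => Im (U x) ^+ 2) <= intT (fun x => Re (U x) ^+ 2).
    have := intC_horner (p ^+ 2); rewrite horner_exp p0 => /(congr1 (@complex.Re R)).
    rewrite -rmorphXn /= => e.
    rewrite -subr_ge0 -intTB; [|exact: bddT_integrable|exact: bddT_integrable].
    have -> : intT (fun x => Re (U x) ^+ 2 - Im (U x) ^+ 2) = (\sum_i c i) ^+ 2.
      rewrite -e; apply: eq_intT => x _.
      by rewrite horner_exp expr2 ReM -!expr2.
    exact: sqr_ge0.
  have Re2int : intT (fun x => Re (U x) ^+ 2) <= L%:R * \sum_i c i ^+ 2.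
    have iS : integrableT (fun x => \sum_i c i ^+ 2 * fejer M (x - xi i)).
      by apply: integrableT_sum => i; apply: integrableTZ; exact: (iK i).1.
    apply: (@le_trans _ _ (intT (fun x => L%:R * \sum_i c i ^+ 2 * fejer M (x - xi i)))).
      by apply: le_intT => //; [exact: bddT_integrable|exact: integrableTZ].
    rewrite intTZ// intT_sum; last by move=> i; apply: integrableTZ; exact: (iK i).1.
    rewrite ler_pM2l// ler_sum// => i _.
    by rewrite intTZ ?(iK i).2 ?mulr1//; exact: (iK i).1.
  have -> : intT (fun x => normc (U x) ^+ 2) =
      intT (fun x => Re (U x) ^+ 2) + intT (fun x => Im (U x) ^+ 2).
    rewrite -intTD; [|exact: bddT_integrable|exact: bddT_integrable].
    by apply: eq_intT => x _; rewrite sqr_normcE.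
  (* Here [c i ^+ 2 = 16 * lam i / M ^+ 2] and [L = 4 * M]. The imaginary part then doubles 256 to
     512. *)
  have E : L%:R * \sum_i c i ^+ 2 = 256 * (\sum_i lam i) / L%:R.
    rewrite L4 mulr_sumr [256 * _]mulrC -mulrA mulr_suml; apply: eq_bigr => i _.
    rewrite /c -{2}(sqr_sqrtr (lam0 i)); field; exact: lt0r_neq0.
  rewrite E in Re2int; move: ImRe Re2int.
  set a := intT _; set b := intT _; lra.
Qed.

End fejer_majorant.

(** * Layer-cake summation of the hypothesis *)

Section finite_stage.
Context (R : realType).

Local Notation Re := complex.Re.
Local Notation Im := complex.Im.

Definition tail_bound (a : nat -> R -> R) (t : R) :=
  forall (E : seq nat) (A : set R), uniq E -> A `<=` Tc R -> measurable A ->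
    \sum_(n <- E) intT (fun x => a n x * \1_A x) <=
    Num.max (size E)%:R (t^-1 * intT \1_A).

(** For [d > 0] and [y >= 0] this is [y] rounded down to a multiple of [d] and capped at [J * d]. It
    is written as a sum over levels so that each level can be treated on its own. *)
Definition staircase (d : R) (J : nat) (y : R) : R :=
  \sum_(j < J) d * ((j.+1)%:R * d <= y)%R%:R.

Lemma staircase_le (d : R) J y : 0 <= d -> 0 <= y -> staircase d J y <= y.
Proof.
move=> d0 y0; elim: J => [|J IH]; first by rewrite /staircase big_ord0.
have [h|h] := leP ((J.+1)%:R * d) y.
  apply: le_trans h; rewrite mulr_natl /staircase -[X in _ *+ X]card_ord -sumr_const.
  by apply: ler_sum => j _; rewrite ler_piMr// lern1 leq_b1.
by rewrite /staircase big_ord_recr /= [_ * d <= y]leNgt h /= mulr0 addr0.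
Qed.

Lemma staircase_ge (d : R) J y : 0 <= d -> 0 <= y <= J%:R * d -> y <= d + staircase d J y.
Proof.
move=> d0; elim: J => [|J IH] /andP[y0 yJ].
  by rewrite /staircase big_ord0; move: yJ; rewrite mul0r; lra.
have [h|h] := leP (J%:R * d) y; last first.
  rewrite /staircase big_ord_recr /= addrA; apply: (le_trans (IH _)); first by rewrite y0 ltW.
  by rewrite lerDl mulr_ge0.
apply: (le_trans yJ).
have -> : (J.+1)%:R * d = J%:R * d + d by rewrite -natr1 mulrDl mul1r.
rewrite addrC lerD2l.
rewrite /staircase big_ord_recr /=.
apply: (@le_trans _ _ (\sum_(j < J) d * ((j.+1)%:R * d <= y)%R%:R)); last first.
  by rewrite lerDl mulr_ge0.
rewrite mulr_natl -[X in _ *+ X]card_ord -sumr_const; apply: ler_sum => j _.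
rewrite (_ : _ <= y = true) ?mulr1//; apply/idP; apply: le_trans h.
by rewrite ler_wpM2r// ler_nat.
Qed.

Lemma integrableT_indicator (A : set R) : measurable A -> integrableT (\1_A : R -> R).
Proof.
move=> mA; have := integrableT_indic mA (bddT_integrable (bddT_cst (1 : R))).
by apply: eq_integrableT => x; rewrite mul1r.
Qed.

(** [min (q_n, y)] reaches a level exactly when both [q_n] and [y] do. So each level uses the
    hypothesis with E the set of [n] with [q_n] above it and F the set where [y] is above it. Levels
    are spaced by [d], and rounding costs at most [d * S]. *)
Lemma layer_cake (a : nat -> R -> R) (t : R) (s : seq nat) (q : nat -> R) (y : R -> R) :
  0 < t -> tail_bound a t -> uniq s ->
  (forall n, integrableT (a n)) -> (forall n x, 0 <= a n x) ->
  (forall n, 0 <= q n) -> bddT y -> (forall x, 0 <= y x) ->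
  \sum_(n <- s) intT (fun x => a n x * Num.min (q n) (y x)) <=
  \sum_(n <- s) q n + t^-1 * intT y.
Proof.
move=> t0 ta us ia a0 q0 by_ y0.
pose S := \sum_(n <- s) intT (a n).
have S0 : 0 <= S by apply: sumr_ge0 => n _; apply: intT_ge0 => x _; exact: a0.
apply/ler_addgt0Pr => e e0.
(* The added 1 keeps the denominator positive when all the [a n] integrate to 0. *)
pose d := e / (S + 1).
have d0 : 0 < d by rewrite divr_gt0// ltr_wpDl.
have dS : d * S <= e.
  by rewrite /d mulrAC ler_pdivrMr ?ler_pM2l//; lra.
(* Enough levels to exceed the sum of the [q n], hence each of them and each minimum. *)
pose J := Num.bound ((\sum_(n <- s) q n) / d).
have qJ n : n \in s -> q n <= J%:R * d.
  move=> ns; apply: (@le_trans _ _ (\sum_(n <- s) q n)).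
    by rewrite (big_rem n)//= lerDl sumr_ge0.
  rewrite -ler_pdivrMr// ltW// /J; apply: le_lt_trans (archi_boundP _) => //.
  by rewrite divr_ge0// ?sumr_ge0// ltW.
pose A j : set R := Tc R `&` [set x | (j.+1)%:R * d <= y x].
have mA j : measurable (A j).
  have := by_.1 (@measurable_Tc R) `[(j.+1)%:R * d, +oo[%classic (measurable_itv _).
  congr measurable; apply/seteqP; split=> x [Tx h]; split=> //; move: h => /=.
    by rewrite in_itv /= andbT.
  by rewrite in_itv /= andbT.
have AE j x : Tc R x -> \1_(A j) x = ((j.+1)%:R * d <= y x)%R%:R :> R.
  move=> Tx; rewrite indicE; congr (_%:R); congr nat_of_bool.
  by apply/idP/idP => [/set_mem []//|h]; apply/mem_set; split.
have ptw n x : n \in s -> Tc R x -> a n x * Num.min (q n) (y x) <=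
    d * a n x + \sum_(j < J) (d * ((j.+1)%:R * d <= q n)%R%:R) * (a n x * \1_(A j) x).
  move=> ns Tx; have an0 := a0 n x.
  have m0 : 0 <= Num.min (q n) (y x) by rewrite le_min q0 y0.
  have mJ : Num.min (q n) (y x) <= J%:R * d by rewrite ge_min qJ.
  have := @staircase_ge d J (Num.min (q n) (y x)) (ltW d0).
  rewrite m0 mJ => /(_ isT) h.
  apply: (le_trans (ler_wpM2l an0 h)); rewrite mulrDr [a n x * d]mulrC lerD2l.
  rewrite /staircase mulr_sumr; apply: ler_sum => j _.
  rewrite AE// le_min.
  case: (_ <= q n); case: (_ <= y x); rewrite /= ?(mulr1, mulr0) ?mul0r//.
  by rewrite mulrC.
have iy n : integrableT (fun x => a n x * Num.min (q n) (y x)).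
  apply: integrableTM => //; split.
    by apply: measurable_minr => //; exact: by_.1.
  exists (q n) => x; rewrite ger0_norm ?ge_min ?lexx// le_min q0 y0//.
have iA n j : integrableT (fun x => a n x * \1_(A j) x) by exact: integrableT_indic.
have step1 : \sum_(n <- s) intT (fun x => a n x * Num.min (q n) (y x)) <=
    d * S + \sum_(j < J) d * \sum_(n <- s | (j.+1)%:R * d <= q n) intT (fun x => a n x * \1_(A j) x).
  apply: (@le_trans _ _ (\sum_(n <- s) (d * intT (a n) +
      \sum_(j < J) (d * ((j.+1)%:R * d <= q n)%R%:R) * intT (fun x => a n x * \1_(A j) x)))).
    rewrite big_seq [leRHS]big_seq; apply: ler_sum => n ns.
    have iS : integrableT (fun x => \sum_(j < J) (d * ((j.+1)%:R * d <= q n)%R%:R) * (a n x * \1_(A j) x)).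
      by apply: integrableT_sum => j; exact: integrableTZ.
    apply: (le_trans (le_intT (iy n) (integrableTD (integrableTZ d (ia n)) iS)
      (fun x => @ptw n x ns))).
    rewrite intTD//; last exact: integrableTZ.
    rewrite intTZ// lerD2l intT_sum; last by move=> j; exact: integrableTZ.
    by apply: ler_sum => j _; rewrite intTZ.
  rewrite big_split /= -mulr_sumr lerD2l exchange_big /=; apply: ler_sum => j _.
  rewrite mulr_sumr [leRHS]big_mkcond /=; apply: ler_sum => n _.
  by case: (_ <= q n); rewrite /= ?mulr1// mulr0 mul0r.
apply: (le_trans step1).
(* The maximum in the hypothesis is relaxed to a sum, so that indices and measure can be summed over
   the levels separately. *)
have step2 (j : 'I_J) : \sum_(n <- s | (j.+1)%:R * d <= q n) intT (fun x => a n x * \1_(A j) x) <=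
    \sum_(n <- s) ((j.+1)%:R * d <= q n)%R%:R + t^-1 * intT (\1_(A j)).
  rewrite -big_filter.
  apply: (le_trans (ta _ _ (filter_uniq _ us) _ (mA j))); first by move=> x [].
  have e1 : (size [seq n <- s | (j.+1)%:R * d <= q n])%:R =
      \sum_(n <- s) ((j.+1)%:R * d <= q n)%R%:R :> R.
    by rewrite -sum1_size natr_sum big_filter big_mkcond /=; apply: eq_bigr => n _; case: (_ <= _).
  have h1 : 0 <= \sum_(n <- s) ((j.+1)%:R * d <= q n)%R%:R :> R by apply: sumr_ge0.
  have h2 : 0 <= t^-1 * intT (\1_(A j)).
    by rewrite mulr_ge0 ?invr_ge0 ?(ltW t0)//; apply: intT_ge0 => x _; rewrite indicE.
  by rewrite e1 ge_max; apply/andP; split; lra.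
have step3 : \sum_(j < J) d * \sum_(n <- s | (j.+1)%:R * d <= q n) intT (fun x => a n x * \1_(A j) x)
   <= \sum_(n <- s) staircase d J (q n) + t^-1 * intT (fun x => \sum_(j < J) d * \1_(A j) x).
  rewrite intT_sum; last by move=> j; apply: integrableTZ; exact: integrableT_indicator.
  rewrite mulr_sumr /staircase exchange_big -big_split /=; apply: ler_sum => j _.
  rewrite intTZ; last exact: integrableT_indicator.
  by rewrite -mulr_sumr [t^-1 * _]mulrCA -mulrDr ler_wpM2l// ltW.
have step4 : intT (fun x => \sum_(j < J) d * \1_(A j) x) <= intT y.
  apply: le_intT.
  - by apply: integrableT_sum => j; apply: integrableTZ; exact: integrableT_indicator.
  - exact: bddT_integrable.
  - move=> x Tx; apply: le_trans (staircase_le J (ltW d0) (y0 x)).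
    by apply: ler_sum => j _; rewrite AE.
have step5 : \sum_(n <- s) staircase d J (q n) <= \sum_(n <- s) q n.
  by apply: ler_sum => n _; apply: staircase_le => //; exact: ltW.
have step6 : t^-1 * intT (fun x => \sum_(j < J) d * \1_(A j) x) <= t^-1 * intT y.
  by rewrite ler_pM2l ?invr_gt0.
lra.
Qed.

Lemma arc_indic (L : nat) (x : R) : (0 < L)%N -> Tc R x ->
  exists i : 'I_L, forall j : 'I_L, \1_(@arc R L j) x = (j == i)%:R :> R.
Proof.
move=> L0; rewrite /Tc /= in_itv /= => /andP[x0 x1].
have L0' : 0 < L%:R :> R by rewrite ltr0n.
have xL0 : 0 <= x * L%:R by rewrite mulr_ge0// ltW.
have xlt : (Num.truncn (x * L%:R) < L)%N.
  by rewrite truncn_lt_nat// -[ltRHS]mul1r ltr_pM2r.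
exists (Ordinal xlt) => j; rewrite indicE; congr (_%:R); congr nat_of_bool.
rewrite -val_eqE /= eq_sym.
apply/idP/idP => [/set_mem|/eqP h].
  rewrite /arc /= in_itv /= ler_pdivrMr// ltr_pdivlMr// => /andP[h1 h2].
  by rewrite truncn_eq// h1.
apply/mem_set; rewrite /arc /= in_itv /= ler_pdivrMr// ltr_pdivlMr// -h.
exact: truncn_itv.
Qed.

Lemma arc_meas (L i : nat) : measurable (@arc R L i).
Proof. exact: measurable_itv. Qed.

(** 5 bounds [smoothstep] on the closed unit disc, and the bound survives convex combinations. *)
Definition admissible (Psi : nat -> R -> R[i]) :=
  forall n, multH1 (Psi n) /\ forall x, normc (Psi n x) <= 5.

Definition gcost (a : nat -> R -> R) (Psi : nat -> R -> R[i]) n :=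
  intT (fun x => a n x * normc (1 - Psi n x)).

Definition hcost (a : nat -> R -> R) (Psi : nat -> R -> R[i]) n (A : set R) :=
  intT (fun x => a n x * normc (Psi n x) * \1_A x).

End finite_stage.

(** * Answering given weights, and the finite problem *)

Section best_response.
Context (R : realType).
Variables (a : nat -> R -> R) (t : R).
Hypotheses (t0 : 0 < t) (ia : forall n, integrableT (a n)) (a0 : forall n x, 0 <= a n x).

Local Notation Re := complex.Re.
Implicit Types P Q : nat -> R -> R[i].

Definition cmix (r : R) (P Q : nat -> R -> R[i]) n x : R[i] :=
  (1 - r)%:C%C * P n x + r%:C%C * Q n x.

Lemma cmix_admissible r P Q : 0 <= r <= 1 -> admissible P -> admissible Q ->
  admissible (cmix r P Q).
Proof.
move=> r01 hP hQ n; have [mP P5] := hP n; have [mQ Q5] := hQ n; split.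
  by apply: multH1D; apply: multH1M => //; exact: multH1_cst.
move=> x; apply: (le_trans (ler_normcD _ _)); rewrite !ComplexField.Normc.normcM !normc_real.
rewrite !ger0_norm; [|lra|lra].
have := P5 x; have := Q5 x; nra.
Qed.

Lemma normc_cmix r P Q n x : 0 <= r <= 1 ->
  normc (cmix r P Q n x) <= (1 - r) * normc (P n x) + r * normc (Q n x).
Proof.
move=> r01; apply: (le_trans (ler_normcD _ _)).
by rewrite !ComplexField.Normc.normcM !normc_real !ger0_norm//; lra.
Qed.

Lemma normc_1cmix r P Q n x : 0 <= r <= 1 ->
  normc (1 - cmix r P Q n x) <= (1 - r) * normc (1 - P n x) + r * normc (1 - Q n x).
Proof.
move=> r01.
have -> : 1 - cmix r P Q n x = (1 - r)%:C%C * (1 - P n x) + r%:C%C * (1 - Q n x).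
  rewrite /cmix rmorphB rmorph1; ring.
apply: (le_trans (ler_normcD _ _)).
by rewrite !ComplexField.Normc.normcM !normc_real !ger0_norm//; lra.
Qed.

Lemma admissible_bdd1 P n : admissible P -> bddC (fun x => 1 - P n x).
Proof. by move=> hP; apply: (bddCD (bddC_cst (1 : R[i]))); apply: bddCN; exact: (hP n).1.1. Qed.

Lemma integrable_gcost P n : admissible P ->
  integrableT (fun x => a n x * normc (1 - P n x)).
Proof. by move=> hP; apply: integrableTM => //; apply: bddC_normcT; exact: admissible_bdd1. Qed.

Lemma integrable_hcost P n (A : set R) : measurable A -> admissible P ->
  integrableT (fun x => a n x * normc (P n x) * \1_A x).
Proof.
move=> mA hP; apply: integrableT_indic => //; apply: integrableTM => //.
by apply: bddC_normcT; exact: (hP n).1.1.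
Qed.

Lemma gcost_ge0 P n : 0 <= gcost a P n.
Proof. by apply: intT_ge0 => x _; rewrite mulr_ge0// normc_ge0. Qed.

Lemma hcost_ge0 P n (A : set R) : 0 <= hcost a P n A.
Proof. by apply: intT_ge0 => x _; rewrite !mulr_ge0// ?normc_ge0// indicE. Qed.

Lemma gcost_le P n : admissible P -> gcost a P n <= 6 * intT (a n).
Proof.
move=> hP; rewrite -intTZ//; apply: le_intT; [exact: integrable_gcost|exact: integrableTZ|].
move=> x _; rewrite mulrC ler_wpM2r//.
apply: (le_trans (ler_normcB _ _)); rewrite ComplexField.Normc.normc1.
by have := (hP n).2 x; lra.
Qed.

Lemma hcost_le P n (A : set R) : measurable A -> admissible P ->
  hcost a P n A <= 5 * intT (a n).
Proof.
move=> mA hP; rewrite -intTZ//; apply: le_intT; [exact: integrable_hcost|exact: integrableTZ|].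
move=> x _; have := (hP n).2 x; have := a0 n x; have := normc_ge0 (P n x).
by rewrite indicE; case: (_ \in _); rewrite ?mulr1 ?mulr0 /=; nra.
Qed.

Lemma gcost_cmix r P Q n : 0 <= r <= 1 -> admissible P -> admissible Q ->
  gcost a (cmix r P Q) n <= (1 - r) * gcost a P n + r * gcost a Q n.
Proof.
move=> r01 hP hQ; have hM := cmix_admissible r01 hP hQ.
rewrite /gcost -!intTZ; [|exact: integrable_gcost|exact: integrable_gcost].
rewrite -intTD; [|apply: integrableTZ; exact: integrable_gcost..].
apply: le_intT; first exact: integrable_gcost.
  by apply: integrableTD; apply: integrableTZ; exact: integrable_gcost.
move=> x _; have := normc_1cmix P Q n x r01; have := a0 n x; nra.
Qed.

Lemma hcost_cmix r P Q n (A : set R) : measurable A -> 0 <= r <= 1 ->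
  admissible P -> admissible Q ->
  hcost a (cmix r P Q) n A <= (1 - r) * hcost a P n A + r * hcost a Q n A.
Proof.
move=> mA r01 hP hQ; have hM := cmix_admissible r01 hP hQ.
rewrite /hcost -!intTZ; [|exact: integrable_hcost|exact: integrable_hcost].
rewrite -intTD; [|apply: integrableTZ; exact: integrable_hcost..].
apply: le_intT; first exact: integrable_hcost.
  by apply: integrableTD; apply: integrableTZ; exact: integrable_hcost.
move=> x _; rewrite indicE; case: (_ \in _); rewrite ?mulr1 ?mulr0 /=; last by rewrite addr0.
have := normc_cmix P Q n x r01; have := a0 n x; nra.
Qed.

Hypothesis ta : tail_bound a t.

Lemma best_response (N M : nat) (q : 'I_N -> R) (lam : 'I_(4 * M) -> R) :
  (0 < M)%N -> (forall n, 0 <= q n) -> (forall i, 0 <= lam i) ->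
  exists2 P, admissible P &
    \sum_n q n * gcost a P n +
    \sum_i lam i * ((4 * M)%:R * t * \sum_(n < N) hcost a P n (arc (4 * M) i)) <=
    4096 * (\sum_n q n + \sum_i lam i).
Proof.
move=> M0 q0 lam0; set L := (4 * M)%N.
have L0 : (0 < L)%N by rewrite muln_gt0.
have L0' : 0 < L%:R :> R by rewrite ltr0n.
(* The factor [L] turns the weights into the values of a step function whose integral is
   [\sum_i lam i]. *)
have [U [mU U0 UL Uint]] := @fejer_majorant R M (fun i => L%:R * lam i) M0
  (fun i => mulr_ge0 (ltW L0') (lam0 i)).
pose qn (n : nat) : R := if insub n is Some i then q i else 0.
have qnE (n : 'I_N) : qn n = q n by rewrite /qn valK.
have qn0 n : 0 <= qn n by rewrite /qn; case: insub.
(* For weight 0 the cost of [1 - Psi_n] does not count, so [Psi_n = 0] is optimal and the quotient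
   [t / q_n] is avoided. *)
pose P n x : R[i] := if qn n == 0 then 0 else
  smoothstep (1 + (Num.sqrt (t / qn n))%:C%C * U x)^-1.
have ReW n x : 1 <= Re (1 + (Num.sqrt (t / qn n))%:C%C * U x).
  by rewrite ReD ReM /= mul0r subr0 lerDl mulr_ge0 ?sqrtr_ge0.
have hP : admissible P.
  move=> n; rewrite /P; case: eqP => _; split.
  - exact: (multH1_cst 0).
  - by move=> x; rewrite ComplexField.Normc.normc0.
  - apply: multH1_smoothstep; apply: multH1_inv => //.
    apply: multH1D; first exact: (multH1_cst 1).
    by apply: multH1M => //; exact: multH1_cst.
  - by move=> x; apply: normc_smoothstep; exact: normc_inv_le1.
exists P => //.
pose v (x : R) : R := \sum_(i < L) (L%:R * lam i) * \1_(arc L i) x.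
have vP x : Tc R x -> 0 <= v x /\ Num.sqrt (v x) <= Re (U x).
  move=> Tx; have [i hi] := arc_indic L0 Tx.
  have vE : v x = L%:R * lam i.
    rewrite /v (bigD1 i)//= hi eqxx mulr1 big1 ?addr0// => j ji.
    by rewrite hi (negbTE ji) mulr0.
  rewrite vE; split; first by rewrite mulr_ge0// ltW.
  apply: UL; have := hi i; rewrite eqxx indicE.
  by case: (boolP (x \in arc L i)) => [/set_mem//|_ /eqP]; rewrite eq_sym oner_eq0.
pose y x := t * normc (U x) ^+ 2.
have y0 x : 0 <= y x by rewrite mulr_ge0 ?sqr_ge0// ltW.
have bU2 : bddT (fun x => normc (U x) ^+ 2) by apply: bddTX; apply: bddC_normcT; exact: mU.1.
have by_ : bddT y by apply: bddTM => //; exact: bddT_cst.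
have ptw n x : Tc R x ->
    a n x * (qn n * normc (1 - P n x) + t * v x * normc (P n x)) <=
    8 * (a n x * Num.min (qn n) (y x)).
  move=> Tx; rewrite mulrCA ler_wpM2l//.
  have [v0 vU] := vP x Tx.
  rewrite /P; case: eqP => [->|/eqP qn1].
    by rewrite mul0r ComplexField.Normc.normc0 mulr0 addr0 mulr_ge0// le_min lexx y0.
  by apply: smoothstep_cost => //; rewrite lt_neqAle eq_sym qn1 qn0.
have iarc (i : 'I_L) n := integrable_hcost n (@arc_meas R L i) hP.
have E : \sum_n q n * gcost a P n + \sum_(i < L) lam i * (L%:R * t * \sum_(n < N) hcost a P n (arc L i)) =
    \sum_(n < N) intT (fun x => a n x * (qn n * normc (1 - P n x) + t * v x * normc (P n x))).
  have -> : \sum_(i < L) lam i * (L%:R * t * \sum_(n < N) hcost a P n (arc L i)) =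
    \sum_(n < N) \sum_(i < L) (t * (L%:R * lam i)) * hcost a P n (arc L i).
    rewrite exchange_big /=; apply: eq_bigr => i _.
    by rewrite !mulr_sumr; apply: eq_bigr => n _; ring.
  rewrite -big_split /=; apply: eq_bigr => n _.
  rewrite -qnE /gcost -intTZ; last exact: integrable_gcost.
  under [X in _ + X]eq_bigr do rewrite -intTZ//.
  rewrite -intT_sum; last by move=> i; exact: integrableTZ.
  rewrite -intTD; last first.
  - by apply: integrableT_sum => i; exact: integrableTZ.
  - by apply: integrableTZ; exact: integrable_gcost.
  apply: eq_intT => x _; rewrite mulrDr; congr (_ + _); first by ring.
  rewrite /v !(mulr_sumr, mulr_suml); apply: eq_bigr => i _; ring.
rewrite E.
have iy n : integrableT (fun x => a n x * Num.min (qn n) (y x)).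
  apply: integrableTM => //; split; first by apply: measurable_minr => //; exact: by_.1.
  by exists (qn n) => x; rewrite ger0_norm ?ge_min ?lexx// le_min qn0 y0.
have i2 n : integrableT (fun x => a n x * (qn n * normc (1 - P n x) + t * v x * normc (P n x))).
  apply: integrableTM => //; apply: bddTD; apply: bddTM.
  - exact: bddT_cst.
  - by apply: bddC_normcT; exact: admissible_bdd1.
  - apply: (bddTM (bddT_cst t)); apply: bddT_sum => i; apply: bddTM; first exact: bddT_cst.
    split; first by apply: measurable_indic; exact: arc_meas.
    by exists 1 => x; rewrite indicE; case: (_ \in _); rewrite ?normr1 ?normr0.
  - by apply: bddC_normcT; exact: (hP n).1.1.
apply: (@le_trans _ _ (\sum_(n < N) 8 * intT (fun x => a n x * Num.min (qn n) (y x)))).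
  apply: ler_sum => n _; rewrite -intTZ//; apply: le_intT => //; first exact: integrableTZ.
  by move=> x; exact: ptw.
have := @layer_cake R a t (iota 0 N) qn y t0 ta (iota_uniq _ _) ia a0 qn0 by_ y0.
rewrite -{1 2}[N]subn0 -/(index_iota 0 N) !big_mkord.
under [X in _ <= X + _ -> _]eq_bigr do rewrite qnE.
rewrite intTZ; last exact: bddT_integrable.
rewrite mulrA mulVf ?gt_eqF// mul1r -mulr_sumr.
(* [t^-1 * int y] is [int |U|^2], hence at most [512 * \sum_i lam i]; the factor 8 of the cost
   inequality gives 4096. *)
have : 512 * (\sum_(i < L) L%:R * lam i) / L%:R = 512 * \sum_(i < L) lam i.
  by rewrite -mulr_sumr; field; rewrite gt_eqF.
move: Uint; rewrite -/L => + e; rewrite e.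
have : 0 <= \sum_n q n by apply: sumr_ge0.
set A := \sum_(n < N) intT _; set B := intT _; lra.
Qed.

(** Minimax with one coordinate per index and one per arc, answered by [best_response]; the slack is
    taken to be 1, whence 4097. *)
Lemma finite_stage (N M : nat) : (0 < M)%N -> exists P, [/\ admissible P,
  forall n, (n < N)%N -> gcost a P n <= 4097 &
  forall i, (i < 4 * M)%N ->
    (4 * M)%:R * t * \sum_(n < N) hcost a P n (arc (4 * M) i) <= 4097].
Proof.
move=> M0; set L := (4 * M)%N.
have L0' : 0 < L%:R :> R by rewrite ltr0n muln_gt0.
pose T := ('I_N + 'I_L)%type.
pose u (P : nat -> R -> R[i]) (x : T) : R := match x with
  | inl n => gcost a P n
  | inr i => L%:R * t * \sum_(n < N) hcost a P n (arc L i) end.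
pose S := [set u P | P in @admissible R].
pose A := \sum_(n < N) intT (a n).
have an0 n : 0 <= intT (a n) by apply: intT_ge0 => x _.
have A0 : 0 <= A by apply: sumr_ge0.
have Lt0 : 0 <= L%:R * t by rewrite mulr_ge0// ltW.
(* The box bound comes from [|1 - Psi| <= 6] and [|Psi| <= 5]; only its finiteness matters, since it
   does not enter the conclusion. *)
have [||||w [P hP <-] hw] :=
  @finite_minimax R _ S (6 * A + L%:R * t * (5 * A)) 4096 _ _ _ _ 1 ltr01.
- exists (u (fun _ _ => 0)), (fun _ _ => 0) => // n.
  by split; [exact: (multH1_cst 0)|move=> x; rewrite ComplexField.Normc.normc0].
- move=> _ [P hP <-] [n|i] /=; apply/andP; split.
  + exact: gcost_ge0.
  + apply: (le_trans (gcost_le n hP)).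
    have : intT (a n) <= A by rewrite /A (bigD1 n)//= lerDl sumr_ge0.
    have : 0 <= L%:R * t * (5 * A) by rewrite mulr_ge0// mulr_ge0.
    lra.
  + by rewrite mulr_ge0// sumr_ge0// => n _; exact: hcost_ge0.
  + have : L%:R * t * (\sum_(n < N) hcost a P n (arc L i)) <= L%:R * t * (5 * A).
      rewrite ler_wpM2l// /A mulr_sumr ler_sum// => n _; apply: hcost_le => //.
      exact: arc_meas.
    lra.
- move=> _ _ r [P hP <-] [Q hQ <-] r01; exists (u (cmix r P Q)).
    by exists (cmix r P Q) => //; exact: cmix_admissible.
  move=> [n|i] /=; first exact: gcost_cmix.
  rewrite [(1 - r) * _]mulrCA [r * _]mulrCA -mulrDr ler_wpM2l//.
  rewrite !mulr_sumr -big_split /=; apply: ler_sum => n _.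
  by apply: hcost_cmix => //; exact: arc_meas.
- move=> w w0.
  have [P hP h] := @best_response N M (fun n => w (inl n)) (fun i => w (inr i)) M0
    (fun n => w0 _) (fun i => w0 _).
  by exists (u P); [exists P|rewrite !big_sumType].
exists P; split=> // [n nN|i iL].
  by have := hw (inl (Ordinal nN)); rewrite /=; lra.
by have := hw (inr (Ordinal iL)); rewrite /=; lra.
Qed.

End best_response.

(** * Almost everywhere convergence from summable increments *)

Lemma sum_half_powers_le (R : realType) m : \sum_(n < m) (2^-1 : R) ^+ n <= 2.
Proof.
have -> : \sum_(n < m) (2^-1 : R) ^+ n = 2 - 2 * 2^-1 ^+ m.
  elim: m => [|m IH]; first by rewrite big_ord0 expr0; lra.
  by rewrite big_ord_recr /= IH exprS; lra.
by rewrite lerBlDr lerDl mulr_ge0// exprn_ge0.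
Qed.

(** Integrating the series of increments term by term shows that its sum is integrable, hence finite
    almost everywhere; there the telescoping series converges absolutely. *)
Lemma ae_cvg_of_summable (R : realType) (u_ : nat -> R -> R) (B : R) :
  (forall n, bddT (u_ n)) ->
  (forall J, \sum_(j < J) intT (fun x => `|u_ j.+1 x - u_ j x|) <= B) ->
  {ae mT R, forall x, Tc R x -> cvgn (u_ ^~ x)}.
Proof.
move=> bu hB.
have ig j : integrableT (fun x => `|u_ j.+1 x - u_ j x|).
  by apply: integrableT_norm; apply: bddT_integrable; exact: bddTB.
pose g (j : nat) x : \bar R := (`|u_ j.+1 x - u_ j x|)%:E.
have mg j : measurable_fun (Tc R : set (measurableTypeR R)) (g j).
  by apply/measurable_EFinP; exact: integrableT_meas (ig j).
have g0 (j : nat) x : (0%:E <= g j x)%E by rewrite lee_fin.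
have iS : (mT R).-integrable (Tc R) (fun x => \sum_(0 <= j <oo) g j x)%E.
  apply/integrableP; split.
    exact: (@ge0_emeasurable_sum _ (measurableTypeR R) R (Tc R) g xpredT (fun j x _ _ => g0 j x) (fun j _ => mg j)).
  have -> : (\int[mT R]_(x in Tc R) `|\sum_(0 <= j <oo) g j x| =
      \int[mT R]_(x in Tc R) \sum_(0 <= j <oo) g j x)%E.
    by apply: eq_integral => x _; rewrite gee0_abs// nneseries_ge0.
  rewrite (@integral_nneseries _ _ _ (mT R) _ (@measurable_TcL R) _ mg (fun j x _ => g0 j x)).
  apply: (@le_lt_trans _ _ B%:E); last exact: ltry.
  apply: lime_le.
    by apply: is_cvg_nneseries => j _ _; apply: integral_ge0 => x _; exact: g0.
  apply: nearW => J; rewrite big_mkord.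
  under eq_bigr do rewrite (intTE (ig _)).
  by rewrite sumEFin lee_fin.
apply: ae_mT_sub (integrable_ae (@measurable_TcL R) iS) => x h Tx.
have {}h := h Tx.
pose v j := `|u_ j.+1 x - u_ j x|.
have cv : cvgn (series v).
  apply: nondecreasing_is_cvgn.
    by apply: nondecreasing_series => n _ _; exact: normr_ge0.
  exists (fine (\sum_(0 <= j <oo) g j x)%E) => _ [n _ <-].
  rewrite -lee_fin fineK// /series /= -sumEFin.
  exact: (@nneseries_lim_ge R (g ^~ x) xpredT 0 n (fun j _ _ => g0 j x)).
have ct : cvgn (series (telescope (u_ ^~ x))).
  by apply: normed_cvg; exact: cv.
have -> : u_ ^~ x = (fun n => u_ 0%N x + series (telescope (u_ ^~ x)) n).
  by apply/funext => n; exact: eq_sum_telescope.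
by apply: is_cvgD => //; exact: is_cvg_cst.
Qed.

(** * Feasible families at increasing levels and their energy *)

Section feasible_sets.
Context (R : realType).
Variables (a : nat -> R -> R) (t : R).
Hypotheses (t0 : 0 < t) (ia : forall n, integrableT (a n)) (a0 : forall n x, 0 <= a n x).
Implicit Types P Q : nat -> R -> R[i].

(** A single [m] limits both the indices and the dyadic scales: the conditions grow with [m], and
    each individual one is present from some level on. *)
Definition feasible m P := [/\ admissible P,
  forall n, (n < m)%N -> gcost a P n <= 4097 &
  forall l i, (l <= m)%N -> (i < 2 ^ l)%N ->
    (2 ^ l)%:R * t * \sum_(n < m) hcost a P n (arc (2 ^ l) i) <= 4097].

Lemma sub_feasible m k P : (m <= k)%N -> feasible k P -> feasible m P.
Proof.
move=> mk [hP hg hh]; split=> // [n nm|l i lm il].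
  by apply: hg; exact: leq_trans mk.
apply: le_trans (hh l i (leq_trans lm mk) il).
rewrite ler_wpM2l ?mulr_ge0 ?(ltW t0)//.
rewrite -!(big_mkord xpredT (fun n => hcost a P n (arc (2 ^ l) i))).
rewrite [leRHS](big_cat_nat _ mk)//= lerDl sumr_ge0// => n _; exact: hcost_ge0.
Qed.

Lemma cmix_feasible m r P Q : 0 <= r <= 1 -> feasible m P -> feasible m Q ->
  feasible m (cmix r P Q).
Proof.
move=> r01 [hP gP hhP] [hQ gQ hhQ]; split; first exact: cmix_admissible.
  move=> n nm; apply: (le_trans (gcost_cmix ia a0 n r01 hP hQ)).
  have := gP _ nm; have := gQ _ nm; nra.
move=> l i lm il; have := hhP l i lm il; have := hhQ l i lm il.
set c := _ * t => h1 h2.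
have c0 : 0 <= c by rewrite mulr_ge0// ltW.
have : \sum_(n < m) hcost a (cmix r P Q) n (arc (2 ^ l) i) <=
    (1 - r) * (\sum_(n < m) hcost a P n (arc (2 ^ l) i)) +
    r * (\sum_(n < m) hcost a Q n (arc (2 ^ l) i)).
  rewrite !mulr_sumr -big_split /=; apply: ler_sum => n _.
  by apply: hcost_cmix => //; exact: arc_meas.
move=> /(ler_wpM2l c0) h; apply: (le_trans h).
rewrite mulrDr mulrCA [X in _ + X]mulrCA; nra.
Qed.

Lemma arc_subdivision (L K i : nat) (x : R) : (0 < L)%N -> (0 < K)%N ->
  \1_(arc L i) x <= \sum_(j < K) \1_(arc (L * K) (i * K + j)) x :> R.
Proof.
move=> L0 K0; rewrite [leLHS]indicE; case: (boolP (x \in _)) => [/set_mem|_]; last first.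
  by apply: sumr_ge0 => j _; rewrite indicE.
have L0' : 0 < L%:R :> R by rewrite ltr0n.
have K0' : 0 < K%:R :> R by rewrite ltr0n.
have LK0 : 0 < (L * K)%:R :> R by rewrite natrM mulr_gt0.
rewrite /arc /= in_itv /= ler_pdivrMr// ltr_pdivlMr// => /andP[x1 x2].
have x0 : 0 <= x by move: x1; rewrite -(pmulr_lge0 _ L0') => h; apply: le_trans h.
have y0 : 0 <= x * (L * K)%:R by rewrite mulr_ge0// ltW.
pose k := Num.truncn (x * (L * K)%:R).
have k1 : (i * K <= k)%N.
  by rewrite /k truncn_ge_nat// !natrM mulrA ler_pM2r.
have k2 : (k < i.+1 * K)%N.
  by rewrite /k truncn_lt_nat// !natrM mulrA ltr_pM2r.
have k3 : (k - i * K < K)%N by rewrite ltn_subLR// -mulSnr.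
rewrite (bigD1 (Ordinal k3))//= -[leLHS]addr0 lerD//; last by apply: sumr_ge0 => j _; rewrite indicE.
rewrite indicE mem_set// subnKC//=.
by rewrite in_itv /= ler_pdivrMr// ltr_pdivlMr//; exact: truncn_itv.
Qed.

(** The finite problem is solved on the finest arcs only. A coarser dyadic arc is covered by [K] of
    them, and adding their bounds gives the same constant after normalization by length. *)
Lemma exists_feasible m : tail_bound a t -> exists P, feasible m P.
Proof.
move=> ta; have M0 : (0 < 2 ^ m)%N by rewrite expn_gt0.
have [P [hP gP hh]] := finite_stage t0 ia a0 ta m M0.
exists P; split=> // l i lm il.
have L0 : (0 < 2 ^ l)%N by rewrite expn_gt0.
pose K := (4 * 2 ^ (m - l))%N.
have K0 : (0 < K)%N by rewrite muln_gt0 expn_gt0.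
have LK : (2 ^ l * K = 4 * 2 ^ m)%N by rewrite /K mulnCA -expnD subnKC.
have L0' : 0 < (2 ^ l)%:R :> R by rewrite ltr0n.
have K0' : 0 < K%:R :> R by rewrite ltr0n.
have h1 n : hcost a P n (arc (2 ^ l) i) <=
    \sum_(j < K) hcost a P n (arc (4 * 2 ^ m) (i * K + j)).
  have ih (A : set R) : measurable A -> integrableT (fun x => a n x * normc (P n x) * \1_A x).
    by move=> mA; exact: integrable_hcost.
  rewrite /hcost -intT_sum; last by move=> j; apply: ih; exact: arc_meas.
  apply: le_intT; first by apply: ih; exact: arc_meas.
    by apply: integrableT_sum => j; apply: ih; exact: arc_meas.
  move=> x _; rewrite -mulr_sumr ler_wpM2l ?mulr_ge0 ?normc_ge0//.
  by rewrite -LK; exact: arc_subdivision.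
have h2 (j : 'I_K) : t * (\sum_(n < m) hcost a P n (arc (4 * 2 ^ m) (i * K + j))) <=
    4097 / (2 ^ l * K)%:R.
  rewrite ler_pdivlMr; last by rewrite natrM mulr_gt0.
  rewrite mulrC mulrA LK; apply: hh; rewrite -LK.
  by apply: (@leq_trans (i * K + K)); rewrite ?ltn_add2l// -mulSnr leq_mul2r il orbT.
apply: (@le_trans _ _ ((2 ^ l)%:R * \sum_(j < K)
    t * (\sum_(n < m) hcost a P n (arc (4 * 2 ^ m) (i * K + j))))).
  rewrite -mulrA ler_pM2l// -mulr_sumr ler_pM2l// exchange_big /=.
  by apply: ler_sum => n _.
apply: (@le_trans _ _ ((2 ^ l)%:R * \sum_(j < K) (4097 / (2 ^ l * K)%:R))).
  by rewrite ler_pM2l// ler_sum.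
rewrite sumr_const card_ord -mulr_natr natrM le_eqVlt; apply/orP; left; apply/eqP.
by field; rewrite !gt_eqF.
Qed.

(** A squared Hilbert norm truncated at [m]. The weights sum to at most 2, so admissible families
    have energy at most [2 * 25], uniformly in [m]. *)
Definition energy m P := \sum_(n < m) 2^-1 ^+ n * intT (fun x => normc (P n x) ^+ 2).

Lemma energy_ge0 m P : 0 <= energy m P.
Proof.
apply: sumr_ge0 => n _; rewrite mulr_ge0 ?exprn_ge0//.
by apply: intT_ge0 => x _; exact: sqr_ge0.
Qed.

Lemma le_energy m k P : (m <= k)%N -> energy m P <= energy k P.
Proof.
move=> mk; rewrite /energy -!(big_mkord xpredT (fun n => 2^-1 ^+ n * intT (fun x => normc (P n x) ^+ 2))).
rewrite [leRHS](big_cat_nat _ mk)//= lerDl sumr_ge0// => n _; rewrite mulr_ge0 ?exprn_ge0//.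
by apply: intT_ge0 => x _; exact: sqr_ge0.
Qed.

Lemma bddT_sqr_normc (F : R -> R[i]) : bddC F -> bddT (fun x => normc (F x) ^+ 2).
Proof. by move=> bF; apply: bddTX; exact: bddC_normcT. Qed.

Lemma energy_le m P : admissible P -> energy m P <= 50.
Proof.
move=> hP; apply: (@le_trans _ _ (\sum_(n < m) 2^-1 ^+ n * 25)).
  apply: ler_sum => n _; rewrite ler_wpM2l ?exprn_ge0//.
  rewrite -[leRHS](intT_cst (25 : R)); apply: le_intT.
  - by apply: bddT_integrable; apply: bddT_sqr_normc; exact: (hP n).1.1.
  - by apply: bddT_integrable; exact: bddT_cst.
  - move=> x _; have := (hP n).2 x; have := normc_ge0 (P n x); rewrite /=; nra.
rewrite -mulr_suml; have := sum_half_powers_le R m; lra.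
Qed.

Lemma energy_parallelogram m P Q : admissible P -> admissible Q ->
  energy m (fun n x => P n x - Q n x) =
  2 * energy m P + 2 * energy m Q - 4 * energy m (cmix 2^-1 P Q).
Proof.
move=> hP hQ; rewrite /energy !mulr_sumr -big_split -sumrB /=; apply: eq_bigr => n _.
have bP := (hP n).1.1; have bQ := (hQ n).1.1.
have h01 : 0 <= (2^-1 : R) <= 1 by lra.
have bM := (cmix_admissible h01 hP hQ n).1.1.
have iP := bddT_integrable (bddT_sqr_normc bP).
have iQ := bddT_integrable (bddT_sqr_normc bQ).
have iM := bddT_integrable (bddT_sqr_normc bM).
suff -> : intT (fun x => normc (P n x - Q n x) ^+ 2) =
    2 * intT (fun x => normc (P n x) ^+ 2) + 2 * intT (fun x => normc (Q n x) ^+ 2) -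
    4 * intT (fun x => normc (cmix 2^-1 P Q n x) ^+ 2) by ring.
rewrite -!intTZ// -intTD; [|exact: integrableTZ|exact: integrableTZ].
rewrite -intTB; [|by apply: integrableTD; exact: integrableTZ|exact: integrableTZ].
apply: eq_intT => x _.
rewrite !sqr_normcE /cmix !ReD !ImD !ReN !ImN !ReM !ImM /=.
by field.
Qed.

End feasible_sets.

(** * Almost minimizers and the limiting multipliers *)

Section limit_multipliers.
Context (R : realType).
Variables (a : nat -> R -> R) (t : R).
Hypotheses (t0 : 0 < t) (ia : forall n, integrableT (a n)) (a0 : forall n x, 0 <= a n x).
Hypothesis ta : tail_bound a t.

Local Notation Re := complex.Re.
Local Notation Im := complex.Im.

(* Midpoints of feasible families are feasible, so by the parallelogram law
   almost minimizers of the energy form a Cauchy sequence. *)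
Lemma cauchy_feasible : exists P_ : nat -> nat -> R -> R[i],
  (forall m, feasible a t m (P_ m)) /\
  forall e : R, 0 < e -> exists m0, forall m k, (m0 <= m)%N -> (m <= k)%N ->
    energy m (fun n x => P_ m n x - P_ k n x) <= e.
Proof.
pose A m := [set energy m P | P in feasible a t m].
have hA m : has_inf (A m).
  split; last by exists 0 => _ [P _ <-]; exact: energy_ge0.
  by have [P hP] := exists_feasible t0 ia a0 m ta; exists (energy m P), P.
have Ale m P : feasible a t m P -> inf (A m) <= energy m P.
  by move=> hP; apply: ge_inf; [exact: (hA m).2|exists P].
have Amono m k : (m <= k)%N -> inf (A m) <= inf (A k).
  move=> mk; apply: lb_le_inf; first exact: (hA k).1.
  move=> _ [P hP <-]; apply: le_trans (le_energy _ mk).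
  by apply: Ale; exact: (sub_feasible t0 a0 mk hP).
have A50 m : inf (A m) <= 50.
  have [P hP] := exists_feasible t0 ia a0 m ta.
  by apply: (le_trans (Ale _ _ hP)); apply: energy_le; case: hP.
have h0 (m : nat) : 0 < (2^-1 : R) ^+ m by rewrite exprn_gt0.
have /choice[P_ hP_] m : exists P, feasible a t m P /\ energy m P <= inf (A m) + 2^-1 ^+ m.
  have [_ [P hP <-] /ltW h] := inf_adherent (h0 m) (hA m).
  by exists P.
exists P_; split; first by move=> m; exact: (hP_ m).1.
move=> e e0.
have hS : has_sup (range (fun m => inf (A m))).
  by split; [exists (inf (A 0%N)), 0%N|exists 50 => _ [m _ <-]].
(* The infima increase with the level and stay below 50, so they gather at their supremum. In the
   parallelogram identity, twice the gap of two infima costs at most [e / 2], and near minimality at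
   most four times [e / 8]. *)
have e4 : 0 < e / 4 by rewrite divr_gt0.
have [_ [m1 _ <-] hm1] := sup_adherent e4 hS.
have [m2 hm2] : exists m2 : nat, (2^-1 : R) ^+ m2 <= e / 8.
  have c : (fun n => (2^-1 : R) ^+ n) @ \oo --> (0 : R).
    by apply: cvg_expr; rewrite ger0_norm; lra.
  have e8 : 0 < e / 8 by rewrite divr_gt0.
  have [N _ hN] : \forall n \near \oo, (2^-1 : R) ^+ n <= e / 8.
    move/cvgrPdist_le : c => /(_ _ e8); apply: filterS => n.
    by rewrite sub0r normrN ger0_norm// ltW.
  by exists N; apply: hN => /=.
exists (maxn m1 m2) => m k; rewrite geq_max => /andP[mm1 mm2] mk.
have [fm em] := hP_ m; have [fk ek] := hP_ k.
have hm : admissible (P_ m) by case: fm.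
have hk : admissible (P_ k) by case: fk.
rewrite energy_parallelogram//.
have h01 : 0 <= (2^-1 : R) <= 1 by lra.
have l1 := Ale m _ (cmix_feasible t0 ia a0 h01 fm (sub_feasible t0 a0 mk fk)).
have l2 := le_energy (P_ k) mk.
have l3 : inf (A k) <= sup (range (fun m => inf (A m))).
  by apply: ub_le_sup; [exact: hS.2|exists k].
have l4 := Amono _ _ mm1.
have le1 : (2^-1 : R) <= 1 by lra.
have l5 : (2^-1 : R) ^+ m <= 2^-1 ^+ m2 by rewrite ler_wiXn2l.
have l6 : (2^-1 : R) ^+ k <= 2^-1 ^+ m2 by rewrite ler_wiXn2l// (leq_trans mm2).
lra.
Qed.

(** The factor [2 ^+ n] undoes the energy weight. The rate [8^-j] is fast enough for the L^1 norms
    of the increments to be summable for each fixed [n]. *)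
Lemma fast_feasible : exists P_ : nat -> nat -> R -> R[i],
  (forall j, feasible a t j (P_ j)) /\
  forall n j, (n <= j)%N ->
    intT (fun x => normc (P_ j n x - P_ j.+1 n x) ^+ 2) <= 2 ^+ n * 2^-1 ^+ (3 * j).
Proof.
have [P_ [fP cP]] := cauchy_feasible.
have h0 (m : nat) : 0 < (2^-1 : R) ^+ m by rewrite exprn_gt0.
have /choice[mu hmu] j := cP _ (h0 (3 * j)%N).
(* Partial sums of [(mu i).+1] are nondecreasing, exceed [mu j], and exceed [j]; the last property
   makes the family of index [phi j] feasible at level [j]. *)
pose phi j := (\sum_(i < j.+1) (mu i).+1)%N.
have phi_mu j : (mu j < phi j)%N by rewrite /phi big_ord_recr /= leq_addl.
have phi_gt j : (j < phi j)%N.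
  rewrite -[X in (X <= _)%N]card_ord -sum1_card; exact: leq_sum.
have phiS j : (phi j <= phi j.+1)%N by rewrite {2}/phi big_ord_recr /= leq_addr.
exists (fun j => P_ (phi j)); split.
  by move=> j; apply: (sub_feasible t0 a0 (ltnW (phi_gt j))).
move=> n j nj.
have := hmu j _ _ (ltnW (phi_mu j)) (phiS j).
have np : (n < phi j)%N by exact: leq_ltn_trans nj (phi_gt j).
rewrite /energy (bigD1 (Ordinal np))//= => h.
have h2 : 0 < (2 : R) ^+ n by rewrite exprn_gt0.
have hX : 0 <= \sum_(i < phi j | i != Ordinal np) 2^-1 ^+ i *
    intT (fun x => normc (P_ (phi j) i x - P_ (phi j.+1) i x) ^+ 2).
  apply: sumr_ge0 => i _; rewrite mulr_ge0 ?exprn_ge0//.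
  by apply: intT_ge0 => x _; exact: sqr_ge0.
rewrite -ler_pdivrMl// -exprVn; lra.
Qed.

(** A measurable choice of limit defined at every point, bounded by 5 by construction because [bddT]
    asks for a bound everywhere. *)
Definition clamp_limsup (u : nat -> R) := Num.max (-5) (Num.min 5 (limn_sup u)).

Lemma clamp_limsup_cvg (u : nat -> R) : (forall n, `|u n| <= 5) -> cvgn u ->
  u @ \oo --> clamp_limsup u.
Proof.
move=> u5 cu; rewrite /clamp_limsup (cvg_limn_supE cu).
rewrite min_r; last first.
  by apply: limr_le => //; apply: nearW => n; have := u5 n; rewrite ler_norml => /andP[].
rewrite max_r//.
by apply: limr_ge => //; apply: nearW => n; have := u5 n; rewrite ler_norml => /andP[].
Qed.

Lemma clamp_limsup_bdd (u : nat -> R -> R) : (forall n, bddT (u n)) ->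
  (forall n x, `|u n x| <= 5) -> bddT (fun x => clamp_limsup (u ^~ x)).
Proof.
move=> bu u5; split.
  apply: measurable_maxr; first exact: measurable_cst.
  apply: measurable_minr; first exact: measurable_cst.
  apply: measurable_fun_limn_sup.
  - by move=> x _; exists 5 => _ [n _ <-]; have := u5 n x; rewrite ler_norml => /andP[].
  - by move=> x _; exists (-5) => _ [n _ <-]; have := u5 n x; rewrite ler_norml => /andP[].
  - by move=> n; exact: (bu n).1.
exists 5 => x; rewrite ler_norml /clamp_limsup le_max lexx /=.
by rewrite ge_max ge_min lexx /= andbT; lra.
Qed.

(** [r] stands for the real or the imaginary part. The inequality [d <= h + d^2 / h] with
    [h = 2^-(j + n)] converts the squared L^2 estimates into summable L^1 ones. *)
Lemma fast_feasible_cvg (P_ : nat -> nat -> R -> R[i]) (r : R[i] -> R) n :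
  (forall j, admissible (P_ j)) ->
  (forall z w, `|r z - r w| <= normc (z - w)) ->
  (forall j, bddT (fun x => r (P_ j n x))) ->
  (forall j, (n <= j)%N ->
    intT (fun x => normc (P_ j n x - P_ j.+1 n x) ^+ 2) <= 2 ^+ n * 2^-1 ^+ (3 * j)) ->
  {ae mT R, forall x, Tc R x -> cvgn (fun j => r (P_ j n x))}.
Proof.
move=> aP rlip br hP.
(* The rate for the [n]-th component is available only from index [n] on. *)
suff : {ae mT R, forall x, Tc R x -> cvgn ((fun j x => r (P_ (j + n)%N n x)) ^~ x)}.
  apply: ae_mT_sub => x h Tx; have /cvg_ex[l hl] := h Tx.
  by apply/cvg_ex; exists l; rewrite -(cvg_shiftn n).
apply: (@ae_cvg_of_summable _ _ 4) => [j|J]; first exact: br.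
apply: (@le_trans _ _ (\sum_(j < J) 2 * 2^-1 ^+ j)); last first.
  by rewrite -mulr_sumr; have := sum_half_powers_le R J; lra.
apply: ler_sum => j _.
set D := fun x => P_ (j + n)%N n x - P_ (j + n).+1 n x.
have bD : bddC D by apply: bddCD; [|apply: bddCN]; exact: (aP _ n).1.1.
pose h : R := 2^-1 ^+ (j + n).
have h0 : 0 < h by rewrite exprn_gt0.
have iD := bddT_integrable (bddT_sqr_normc bD).
apply: (@le_trans _ _ (intT (fun x => cst h x + h^-1 * normc (D x) ^+ 2))).
  apply: le_intT.
  - apply: integrableT_norm; apply: bddT_integrable; apply: bddTB; exact: br.
  - by apply: integrableTD; [apply: bddT_integrable; exact: bddT_cst|exact: integrableTZ].
  - move=> x _; rewrite distrC; apply: (le_trans (rlip _ _)); rewrite -/(D x) /=.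
    rewrite -(ler_pM2l h0) mulrDr mulrA divff ?gt_eqF// mul1r.
    by set d := normc (D x); have := sqr_ge0 (h - d); nra.
rewrite intTD; [|by apply: bddT_integrable; exact: bddT_cst|exact: integrableTZ].
rewrite intT_cst intTZ//.
have := hP (j + n)%N (leq_addl _ _); rewrite -/D mulnC exprM -/h => hD.
have hj : h = 2^-1 ^+ j * 2^-1 ^+ n by rewrite /h exprD.
have e1 : h^-1 * (2 ^+ n * h ^+ 3) = h * 2^-1 ^+ j.
  have -> : h^-1 * (2 ^+ n * h ^+ 3) = 2 ^+ n * h * h by field; rewrite gt_eqF.
  rewrite {1}hj mulrCA -exprMn mulfV// expr1n mulr1; exact: mulrC.
have l1 : h^-1 * intT (fun x => normc (D x) ^+ 2) <= h * 2^-1 ^+ j.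
  by rewrite -e1 ler_pM2l// invr_gt0.
have j0 : 0 < (2^-1 : R) ^+ j by rewrite exprn_gt0.
have j1 : (2^-1 : R) ^+ j <= 1 by rewrite exprn_ile1//; lra.
have n1 : (2^-1 : R) ^+ n <= 1 by rewrite exprn_ile1//; lra.
have l2 : h <= 2^-1 ^+ j by rewrite hj ler_piMr// ltW.
have l3 : h * 2^-1 ^+ j <= h by rewrite ler_piMr// ltW.
lra.
Qed.

(** Each cost converges by dominated convergence, with majorants [6 a_n] and [5 a_n]. Each fixed
    constraint holds along the tail of the sequence, so the limit satisfies all of them at once. *)
Lemma limit_multipliers : exists Psi : nat -> R -> R[i],
  [/\ forall n, multH1 (Psi n), forall n, gcost a Psi n <= 4097 &
   forall N l i, (i < 2 ^ l)%N ->
     (2 ^ l)%:R * t * \sum_(n < N) hcost a Psi n (arc (2 ^ l) i) <= 4097].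
Proof.
have [P_ [fP hP]] := fast_feasible.
have aP j : admissible (P_ j) by case: (fP j).
have bR j n := (aP j n).1.1.1; have bI j n := (aP j n).1.1.2.
have R5 j n x : `|Re (P_ j n x)| <= 5 by apply: le_trans (normc_Re _) ((aP j n).2 x).
have I5 j n x : `|Im (P_ j n x)| <= 5 by apply: le_trans (normc_Im _) ((aP j n).2 x).
pose Psi n x : R[i] := Complex (clamp_limsup (fun j => Re (P_ j n x)))
                               (clamp_limsup (fun j => Im (P_ j n x))).
have bPsi n : bddC (Psi n).
  split; [apply: (@clamp_limsup_bdd (fun j x => Re (P_ j n x))) => j|
          apply: (@clamp_limsup_bdd (fun j x => Im (P_ j n x))) => j] => //.
have cPsi n : {ae mT R, forall x, Tc R x -> cvgC (fun j => P_ j n x) (Psi n x)}.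
  have c1 : {ae mT R, forall x, Tc R x -> cvgn (fun j => Re (P_ j n x))}.
    apply: fast_feasible_cvg => // [z w|j]; last exact: hP.
    by rewrite -ReN -ReD normc_Re.
  have c2 : {ae mT R, forall x, Tc R x -> cvgn (fun j => Im (P_ j n x))}.
    apply: fast_feasible_cvg => // [z w|j]; last exact: hP.
    by rewrite -ImN -ImD normc_Im.
  apply: ae_mT_sub (ae_mT_and c1 c2) => x [h1 h2] Tx; split.
    by apply: clamp_limsup_cvg => //; exact: h1.
  by apply: clamp_limsup_cvg => //; exact: h2.
have cg n : gcost a (P_ j) n @[j --> \oo] --> gcost a Psi n.
  apply: (proj2 (@cvg_intT _ (fun j x => a n x * normc (1 - P_ j n x)) _
    (fun x => 6 * a n x) _ _ (integrableTZ 6 (ia n)) _ _)).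
  - by move=> j; apply: integrableT_meas; exact: integrable_gcost.
  - apply: integrableT_meas; apply: integrableTM => //; apply: bddC_normcT.
    by apply: (bddCD (bddC_cst (1 : R[i]))); exact: bddCN.
  - move=> j x _; rewrite ger0_norm ?mulr_ge0 ?normc_ge0// mulrC ler_wpM2r//.
    apply: (le_trans (ler_normcB _ _)); rewrite ComplexField.Normc.normc1.
    by have := (aP j n).2 x; lra.
  - apply: ae_mT_sub (cPsi n) => x h Tx; apply: cvgM; first exact: cvg_cst.
    apply: cvgC_normc; have [h1 h2] := h Tx; split.
      rewrite ReD ReN; under eq_fun do rewrite ReD ReN.
      by apply: cvgB => //; exact: cvg_cst.
    rewrite ImD ImN; under eq_fun do rewrite ImD ImN.
    by apply: cvgB => //; exact: cvg_cst.
have ch n (A : set R) : measurable A -> hcost a (P_ j) n A @[j --> \oo] --> hcost a Psi n A.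
  move=> mA; apply: (proj2 (@cvg_intT _ (fun j x => a n x * normc (P_ j n x) * \1_A x) _
    (fun x => 5 * a n x) _ _ (integrableTZ 5 (ia n)) _ _)).
  - by move=> j; apply: integrableT_meas; exact: integrable_hcost.
  - apply: integrableT_meas; apply: integrableT_indic => //; apply: integrableTM => //.
    exact: bddC_normcT.
  - move=> j x _; rewrite ger0_norm ?mulr_ge0 ?normc_ge0 ?indicE//.
    have := (aP j n).2 x; have := a0 n x; have := normc_ge0 (P_ j n x).
    by case: (_ \in _); rewrite ?mulr1 ?mulr0 /=; nra.
  - apply: ae_mT_sub (cPsi n) => x h Tx; apply: cvgM; last exact: cvg_cst.
    by apply: cvgM; [exact: cvg_cst|apply: cvgC_normc; exact: h].
exists Psi; split.
- move=> n; apply: (@multH1_lim _ (fun j => P_ j n) _ 5) => //.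
  + by move=> j; exact: (aP j n).1.
  + by move=> j x; exact: (aP j n).2.
- move=> n; rewrite -(cvg_lim (@Rhausdorff R) (cg n)).
  apply: limr_le; first by apply/cvg_ex; exists (gcost a Psi n).
  exists n.+1 => // j /= nj; have [_ h _] := fP j; exact: h.
- move=> N l i il.
  have c : (2 ^ l)%:R * t * \sum_(n < N) hcost a (P_ j) n (arc (2 ^ l) i) @[j --> \oo] -->
      (2 ^ l)%:R * t * \sum_(n < N) hcost a Psi n (arc (2 ^ l) i).
    apply: cvgM; first exact: cvg_cst.
    elim: (N) => [|K IH].
      by rewrite big_ord0; under eq_fun do rewrite big_ord0; exact: cvg_cst.
    rewrite big_ord_recr; under eq_fun do rewrite big_ord_recr.
    by apply: cvgD => //; apply: ch; exact: arc_meas.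
  rewrite -(cvg_lim (@Rhausdorff R) c).
  apply: limr_le; first by apply/cvg_ex; eexists; exact: c.
  exists (maxn N l) => // j /=; rewrite geq_max => /andP[Nj lj].
  have [_ _ h] := fP j; apply: le_trans (h l i lj il).
  rewrite ler_wpM2l ?mulr_ge0 ?(ltW t0)//.
  rewrite -!(big_mkord xpredT (fun n => hcost a (P_ j) n (arc (2 ^ l) i))).
  by rewrite [leRHS](big_cat_nat _ Nj)//= lerDl sumr_ge0// => n _; exact: hcost_ge0.
Qed.

End limit_multipliers.

(** * From dyadic averages to pointwise bounds *)

Section dyadic_differentiation.
Context (R : realType).

Lemma integral_indicT (g : R -> R) (A : set R) : integrableT g -> measurable A ->
  A `<=` Tc R ->
  (\int[mT R]_(x in A) (g x)%:E = (intT (fun x => g x * \1_A x))%:E)%E.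
Proof.
move=> ig mA AT; rewrite -intTE; last exact: integrableT_indic.
rewrite [LHS]integral_mkcond [RHS]integral_mkcond; apply: eq_integral => x _.
rewrite /patch indicE; case: (boolP (x \in A)) => xA.
  by rewrite mem_set ?mulr1//; apply: AT; exact: set_mem.
by rewrite mulr0; case: ifP.
Qed.

(** The ball of radius [2 * 2^-n] about [x] contains the interval and is 4 times as long. *)
Lemma nicely_shrinking_itv (x : R) (y : nat -> R) :
  (forall n, y n <= x < y n + 2^-1 ^+ n) ->
  nicely_shrinking x (fun n => `[y n, y n + 2^-1 ^+ n[%classic).
Proof.
move=> hy.
have h0 (n : nat) : 0 < (2^-1 : R) ^+ n by rewrite exprn_gt0.
have r0 (n : nat) : 0 < 2 * (2^-1 : R) ^+ n by rewrite mulr_gt0.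
split; first by move=> n; exact: measurable_itv.
exists (4, fun n => PosNum (r0 n)); split => //=.
- rewrite -[X in _ --> X](mulr0 (2 : R)); apply: cvgM; first exact: cvg_cst.
  by apply: cvg_expr; rewrite ger0_norm; lra.
- move=> n z /=; rewrite in_itv /= => /andP[z1 z2]; have /andP[x1 x2] := hy n.
  by rewrite /ball /= ltr_norml; have := h0 n; lra.
- move=> n; rewrite lebesgue_measure_ball ?(ltW (r0 n))// lebesgue_measure_itv /=.
  rewrite lte_fin ltrDl h0 -EFinB -EFinM lee_fin.
  have := h0 n; lra.
Qed.

Lemma ae_le_dyadic_average (g : R -> R) (c : R) : integrableT g ->
  (forall l i, (i < 2 ^ l)%N -> (2 ^ l)%:R * intT (fun x => g x * \1_(arc (2 ^ l) i) x) <= c) ->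
  {ae mT R, forall x, Tc R x -> g x <= c}.
Proof.
move=> ig hc.
(* Extension by 0, since differentiation is applied on the whole line. *)
pose f : R -> R := g \_ (Tc R).
have mf : measurable_fun setT f.
  exact: ((measurable_restrictT g (@measurable_Tc R)).1 (integrableT_meas ig)).
have locf : locally_integrable setT f.
  split=> //; first exact: openT.
  move=> K _ cK; apply: (@le_lt_trans _ _ (\int[mT R]_x `|f x|%:E)%E).
    apply: ge0_subset_integral => //.
    - exact: compact_measurable.
    - by apply/measurable_EFinP; apply: measurableT_comp.
  have -> : (\int[mT R]_x `|f x|%:E = \int[mT R]_(x in Tc R) `|g x|%:E)%E.
    rewrite [RHS]integral_mkcond; apply: eq_integral => x _.
    by rewrite /f /patch; case: ifP; rewrite ?normr0.
  by have /integrableP[_] := ig.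
(* Left end of the dyadic arc of rank [n] containing [x]. Off the circle the value [x] keeps the
   intervals shrinking nicely there too. *)
pose y x n : R := if x \in Tc R then (Num.truncn (x * 2 ^+ n))%:R / 2 ^+ n else x.
pose E x n : set R := `[y x n, y x n + 2^-1 ^+ n[%classic.
have p0 (n : nat) : 0 < (2 : R) ^+ n by rewrite exprn_gt0.
have hy x n : y x n <= x < y x n + 2^-1 ^+ n.
  rewrite /y; case: ifPn => [/set_mem|_]; last by rewrite lexx ltrDl exprn_gt0.
  rewrite /Tc /= in_itv /= => /andP[x0 x1].
  rewrite exprVn -[X in _ / _ + X]mul1r -mulrDl natr1 ler_pdivrMr// ltr_pdivlMr//.
  by apply: truncn_itv; rewrite mulr_ge0// ltW.
have nE x : nicely_shrinking x (E x) by exact: nicely_shrinking_itv.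
apply: ae_mT_sub (lebesgue_differentiation locf) => x lx Tx.
have := nice_lebesgue_differentiation nE locf lx.
have -> : f x = g x by rewrite /f /patch mem_set.
move=> cv; rewrite -lee_fin -(cvg_lim _ cv)//.
apply: lime_le; first by apply/cvg_ex; eexists; exact: cv.
apply: nearW => n.
have x01 := Tx; rewrite /Tc /= in_itv /= in x01; have /andP[x0 x1] := x01.
pose i := Num.truncn (x * 2 ^+ n).
have iln : (i < 2 ^ n)%N.
  by rewrite truncn_lt_nat ?mulr_ge0 ?(ltW (p0 n))// natrX -[ltRHS]mul1r ltr_pM2r.
have EE : E x n = arc (2 ^ n) i.
  rewrite /E /arc /y mem_set// natrX -[i.+1]addn1 natrD mulrDl exprVn mul1r.
  by rewrite -/i.
have arcT : arc (2 ^ n) i `<=` Tc R.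
  move=> z; rewrite /arc /Tc /= !in_itv /= => /andP[z1 z2]; apply/andP; split.
    by apply: le_trans z1; rewrite divr_ge0.
  apply: (lt_le_trans z2); rewrite natrX ler_pdivrMr// mul1r -natrX ler_nat//.
have mE : lebesgue_measure (E x n) = (2^-1 ^+ n)%:E :> \bar R.
  by rewrite /E lebesgue_measure_itv /= lte_fin ltrDl exprn_gt0// -EFinB addrAC subrr add0r.
rewrite mE inver gt_eqF ?exprn_gt0// EE.
have -> : (\int[lebesgue_measure]_(z in arc (2 ^ n) i) (f z)%:E =
    (intT (fun z => g z * \1_(arc (2 ^ n) i) z))%:E)%E.
  rewrite -integral_indicT//; last exact: arc_meas.
  apply: eq_integral => z /set_mem za; rewrite /f /patch mem_set//; exact: arcT.
rewrite -EFinM lee_fin; have := hc n i iln.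
by rewrite natrX -exprVn invrK.
Qed.

End dyadic_differentiation.

(** * Assembling the decomposition *)

Theorem theorem4p3 (R : realType) :
  exists C : R,
  forall (f : nat -> cfun R) (t : R),
    0 < t ->
    (forall n, H1 (f n)) ->
    (forall (E : seq nat) (F : set R),
        uniq E -> F `<=` Tc R -> measurable F ->
        (\sum_(n <- E) int_abs (f n) F <=
           maxe ((size E)%:R)%:E ((t^-1)%:E * mT R F))%E) ->
    exists g h : nat -> cfun R,
      [/\ (forall n, H1 (g n)),
          (forall n, Hinf (h n)),
          (forall n x, Tc R x -> (f n).1 x = (cf_add (g n) (h n)).1 x /\
                                 (f n).2 x = (cf_add (g n) (h n)).2 x),
          (forall n, (int_abs (g n) (Tc R) <= C%:E)%E) &
          {ae mT R, forall x, Tc R x ->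
             (\sum_(0 <= n <oo) (cabs (h n) x)%:E <= (C / t)%:E)%E}].
Proof.
exists 4097 => f t t0 H1f hf.
pose F n x : R[i] := Complex ((f n).1 x) ((f n).2 x).
have H1F n : H1c (F n).
  apply/H1cP; have := H1f n; congr H1.
  by rewrite /cfun_of /F /=; case: (f n).
pose a n x : R := normc (F n x).
have ia n : integrableT (a n) by apply: integrableC_normc; exact: (H1F n).1.
have a0 n x : 0 <= a n x by exact: normc_ge0.
have aE n x : cabs (f n) x = a n x by [].
have ta : tail_bound a t.
  move=> E A uE AT mA; have := hf E A uE AT mA.
  rewrite /int_abs; under eq_bigr do rewrite (integral_indicT (ia _) mA AT).
  have -> : mT R A = (intT (\1_A : R -> R))%:E.
    have := @integral_cst _ _ _ (mT R) A mA 1%:E; rewrite mul1e => e1.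
    apply: etrans (esym e1) _.
    rewrite [LHS](integral_indicT (bddT_integrable (bddT_cst (1 : R))) mA AT).
    by congr (intT _)%:E; apply/funext => x; rewrite mul1r.
  by rewrite sumEFin -EFinM -EFin_max lee_fin.
have [Psi [mPsi gPsi hPsi]] := limit_multipliers t0 ia a0 ta.
pose h n := cfun_of (fun x => F n x * Psi n x).
pose g n := cfun_of (fun x => F n x * (1 - Psi n x)).
have m1Psi n : multH1 (fun x => 1 - Psi n x) by apply: multH1B => //; exact: (multH1_cst 1).
have cabsE (G : R -> R[i]) x : cabs (cfun_of G) x = normc (G x).
  by rewrite /cabs /=; case: (G x).
(* A countable union of null sets gives one exceptional set for all partial sums; this serves both
   the bound on each [h n] and the bound on the series. *)
have bound : {ae mT R, forall x, forall N, Tc R x ->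
    t * \sum_(n < N) a n x * normc (Psi n x) <= 4097}.
  apply: ae_mT_foralln => N.
  have iN n : integrableT (fun x => a n x * normc (Psi n x)).
    by apply: integrableTM => //; apply: bddC_normcT; exact: (mPsi n).1.
  apply: (@ae_le_dyadic_average R (fun x => t * \sum_(n < N) a n x * normc (Psi n x))).
    by apply: integrableTZ; apply: integrableT_sum => n.
  move=> l i il; apply: le_trans (hPsi N l i il).
  rewrite -mulrA ler_wpM2l// /hcost -intT_sum; last first.
    by move=> n; apply: integrableT_indic => //; exact: arc_meas.
  rewrite -intTZ; last first.
    by apply: integrableT_sum => n; apply: integrableT_indic => //; exact: arc_meas.
  rewrite le_eqVlt; apply/orP; left; apply/eqP; apply: eq_intT => x _.
  by rewrite -mulrA mulr_suml.
have H1h n : H1 (h n) by apply/H1cP; exact: (mPsi n).2.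
exists g, h; split.
- by move=> n; apply/H1cP; exact: (m1Psi n).2.
- move=> n; split=> //; exists (4097 / t).
  (* The partial sum up to [n.+1] contains the term of index [n]. *)
  apply: ae_mT_sub bound => x /(_ n.+1) hx Tx; have {}hx := hx Tx.
  rewrite cabsE ComplexField.Normc.normcM ler_pdivlMr// mulrC; apply: le_trans hx.
  rewrite ler_pM2l// big_ord_recr /= lerDr sumr_ge0// => k _.
  by rewrite mulr_ge0// normc_ge0.
- by move=> n x _; rewrite /cf_add /= -!ReD -!ImD -!mulrDr subrK mulr1.
- move=> n; rewrite /int_abs.
  have -> : (\int[mT R]_(x in Tc R) (cabs (g n) x)%:E =
      \int[mT R]_(x in Tc R) (a n x * normc (1 - Psi n x))%:E)%E.
    by apply: eq_integral => x _; rewrite cabsE ComplexField.Normc.normcM.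
  rewrite intTE ?lee_fin; first exact: gPsi.
  by apply: integrableTM => //; apply: bddC_normcT; exact: (m1Psi n).1.
- apply: ae_mT_sub bound => x hx Tx.
  apply: lime_le.
    by apply: is_cvg_nneseries => n _ _; rewrite lee_fin cabsE normc_ge0.
  apply: nearW => N; rewrite big_mkord sumEFin lee_fin ler_pdivlMr// mulrC.
  apply: le_trans (hx N Tx); rewrite ler_pM2l//; apply: ler_sum => n _.
  by rewrite cabsE ComplexField.Normc.normcM.
Qed.
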